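(* Let $A$ be a graded algebra over a field $k$ and let $B$ be a relative noncommutative complete intersection (RNCI) of $A$; that is, $B=A/I$ where $I$ is a two-sided ideal generated by a strongly free set in $A$. If the algebra $B$ is right Noetherian, then the algebra $A$ is right graded coherent.
   Context: A graded algebra is an $\mathbb N$-graded associative $k$-algebra $A=A_0\oplus A_1\oplus\cdots$ which is connected ($A_0=k$) and finitely generated. All modules are $\mathbb Z$-graded and all elements and maps are homogeneous. Let $X$ be a set of homogeneous elements of $A$ which minimally generates a two-sided ideal $I$, and let $B=A/I$. The set $X$ is called strongly free if there is an isomorphism of graded vector spaces $B\langle X\rangle\simeq A$, where $B\langle X\rangle=B*k\langle X\rangle$ is the free product of $B$ with the free algebra $k\langle X\rangle$ on $X$ (elements of $X$ keeping their degrees in $A$). In this situation $B=A/I$ is called a relative noncommutative complete intersection (RNCI) of $A$. The algebra $A$ is called right graded coherent if every finitely generated homogeneous right ideal of $A$ is finitely presented as a right $A$-module. *)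

(* Defs.v *)
From mathcomp Require Import all_boot all_order all_algebra.
From mathcomp Require Import boolp classical_sets.

Set Implicit Arguments.
Unset Strict Implicit.
Unset Printing Implicit Defensive.

Import GRing.Theory.
Local Open Scope classical_set_scope.
Local Open Scope ring_scope.

Section Ideals.
Variable R : nzRingType.
Implicit Types J X : set R.

Definition right_ideal J :=
  [/\ J 0, forall a b, J a -> J b -> J (a + b) & forall a r, J a -> J (a * r)].

Definition two_sided_ideal J := right_ideal J /\ forall r a, J a -> J (r * a).

Definition ideal_gen X : set R := smallest two_sided_ideal X.

Definition minimally_generates X J :=
  ideal_gen X = J /\ forall Y, Y `<=` X -> ideal_gen Y = J -> Y = X.

Definition finitely_generated_right J :=
  exists s : seq R, J = smallest right_ideal [set` s].

Definition right_noetherian :=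
  forall J, right_ideal J -> finitely_generated_right J.

End Ideals.

Section Gradings.
Variables (k : fieldType) (A : algType k).
Implicit Types (gr : nat -> set A) (J : set A).

(* The last two clauses say that A is the direct sum of the gr n. *)
Definition grading gr :=
  [/\ forall n, submod_closed (mem (gr n)),
      gr 0 1,
      forall m n a b, gr m a -> gr n b -> gr (m + n)%N (a * b),
      forall a, exists n (u : nat -> A),
        (forall i, gr i (u i)) /\ a = \sum_(i < n) u i &
      forall n (u : nat -> A), (forall i, gr i (u i)) ->
        \sum_(i < n) u i = 0 -> forall i, (i < n)%N -> u i = 0].

Definition connected gr := gr 0 = range (fun c : k => c%:A).

Definition finitely_generated_algebra :=
  exists s : seq A,
    smallest (fun S : set A => subalg_closed (mem S)) [set` s] = setT.

Definition graded_algebra gr :=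
  [/\ grading gr, connected gr & finitely_generated_algebra].

Definition homogeneous_elements gr : set A := \bigcup_n gr n.

Definition homogeneous gr J :=
  forall n (u : nat -> A), (forall i, gr i (u i)) ->
    J (\sum_(i < n) u i) -> forall i, (i < n)%N -> J (u i).

(* J has a presentation F1 --h--> F0 --g--> J --> 0 by graded free right
   modules F0 (basis of degrees d) and F1 (basis of degrees e), with g and h
   of degree 0.  Free right modules are column vectors, on which right-linear
   maps act by left multiplication; since A is concentrated in degrees >= 0,
   an entry of h of negative degree must vanish. *)
Definition finitely_presented_right gr J :=
  exists (n m : nat) (d : 'I_n -> nat) (e : 'I_m -> nat)
         (g : 'rV[A]_n) (h : 'M[A]_(n, m)),
    [/\ forall i, gr (d i) (g 0 i),
        forall i j, if (d i <= e j)%N then gr (e j - d i)%N (h i j)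
                    else h i j = 0,
        J = range (fun u : 'cV[A]_n => (g *m u) 0 0) &
        [set u : 'cV[A]_n | g *m u = 0] = range (fun v : 'cV[A]_m => h *m v)].

Definition right_graded_coherent gr :=
  forall J, right_ideal J -> homogeneous gr J ->
    finitely_generated_right J -> finitely_presented_right gr J.

End Gradings.

Section FreeProducts.
Variable k : fieldType.

Definition free_algebra (T : Type) (F : algType k) (iota : T -> F) :=
  forall (D : algType k) (f : T -> D),
    exists2 h : {lrmorphism F -> D}, (forall x, h (iota x) = f x) &
      forall h' : {lrmorphism F -> D}, (forall x, h' (iota x) = f x) -> h' =1 h.

Definition free_product (B1 B2 C : algType k)
    (i1 : {lrmorphism B1 -> C}) (i2 : {lrmorphism B2 -> C}) :=
  forall (D : algType k) (f1 : {lrmorphism B1 -> D}) (f2 : {lrmorphism B2 -> D}),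
    exists2 h : {lrmorphism C -> D}, h \o i1 =1 f1 /\ h \o i2 =1 f2 &
      forall h' : {lrmorphism C -> D},
        h' \o i1 =1 f1 -> h' \o i2 =1 f2 -> h' =1 h.

End FreeProducts.

Section StronglyFree.
Variables (k : fieldType) (A : algType k) (gr : nat -> set A).

(* pi exhibits B as the quotient algebra A / I. *)
Definition quotient_map (B : algType k) (pi : {lrmorphism A -> B}) (I : set A) :=
  range pi = setT /\ [set a | pi a = 0] = I.

Definition quotient_grading (B : algType k) (pi : {lrmorphism A -> B}) (n : nat) :
  set B := pi @` gr n.

(* Graded vector spaces B<X> and A are isomorphic, where C = B * F is the free
   product of B with the free algebra F = k<X>.  The conditions on grC
   determine it uniquely, as C is generated by the images of B and X. *)
Definition free_extension_iso (X : set A) (B : algType k)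
    (pi : {lrmorphism A -> B}) :=
  exists (F : algType k) (iota : X -> F) (C : algType k)
         (iB : {lrmorphism B -> C}) (iF : {lrmorphism F -> C})
         (grC : nat -> set C) (phi : {linear C -> A}),
    [/\ free_algebra iota /\ free_product iB iF,
        grading grC,
        forall n b, quotient_grading pi n b -> grC n (iB b),
        forall n (x : X), gr n (val x) -> grC n (iF (iota x)) &
        bijective phi /\ forall n c, grC n c <-> gr n (phi c)].

Definition strongly_free (X : set A) :=
  [/\ X `<=` homogeneous_elements gr,
      minimally_generates X (ideal_gen X) &
      exists (B : algType k) (pi : {lrmorphism A -> B}),
        quotient_map pi (ideal_gen X) /\ free_extension_iso X pi].

Definition RNCI (B : algType k) (pi : {lrmorphism A -> B}) :=
  exists2 X : set A, strongly_free X & quotient_map pi (ideal_gen X).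

End StronglyFree.

(* Main.v *)
(* Let g be the row of homogeneous generators of a right ideal J and K the
   module of relations between them; one has to show that K is finitely
   generated.  The point is that I = (X) is free as a left A-module, so that
   Tor_1^A(J, B) = 0: the relations with entries in I form K I.  Hence K / K I
   embeds in a free module of finite rank over the Noetherian ring B, and
   finitely many homogeneous elements of K generate K modulo K I.  As I lives
   in positive degrees, graded Nakayama shows that they generate K.

   For the freeness of I, choose a graded section s of A -> B and let phi be
   the given isomorphism from C = B * k<X> to A.  The decomposition
   C = B (+) (C (x) kX (x) B) allows one to define psi : C -> A by
   psi(b) = s(b) and psi(c x b) = phi(c) x s(b).  It is graded and onto, hence
   bijective since A and C have the same finite Hilbert series, and it carries
   the basis of C (x) kX (x) B over C to one of I over A.  The maps out of C
   are obtained from its universal property with values in algebras of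
   triangular matrices. *)

Require Import Defs.
From HB Require Import structures.
From mathcomp Require Import all_boot all_order all_algebra.
From mathcomp Require Import boolp classical_sets functions.
From mathcomp Require Import zify.

Set Implicit Arguments.
Unset Strict Implicit.
Unset Printing Implicit Defensive.

Import GRing.Theory.
Local Open Scope classical_set_scope.
Local Open Scope ring_scope.

(** * Maps out of a free extension *)

Section FreeExtension.
Variables (k : fieldType) (T : Type) (B C : algType k).
Variables (iB : {lrmorphism B -> C}) (xi : T -> C).

(** The universal property of [B * k<T>] with the free algebra eliminated: an algebra map out of [C]
    amounts to an algebra map on [B] together with arbitrary values on [T]. *)
Definition free_extension :=
  forall (D : algType k) (f : {lrmorphism B -> D}) (e : T -> D),
    exists2 h : {lrmorphism C -> D},
      (forall b, h (iB b) = f b) /\ (forall x, h (xi x) = e x) &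
      forall h' : {lrmorphism C -> D},
        (forall b, h' (iB b) = f b) -> (forall x, h' (xi x) = e x) -> h' =1 h.

End FreeExtension.

Lemma free_product_extension (k : fieldType) (T : Type) (B F C : algType k)
    (iota : T -> F) (iB : {lrmorphism B -> C}) (iF : {lrmorphism F -> C}) :
  free_algebra iota -> free_product iB iF ->
  free_extension iB (fun x => iF (iota x)).
Proof.
move=> freeF prodC D f e.
have [fe feE fe_uniq] := freeF D e.
have [h [hB hF] h_uniq] := prodC D f fe.
exists h; first by split=> [b|x]; [exact: hB | rewrite -feE; exact: hF].
move=> h' h'B h'F; apply: h_uniq => // y.
by apply: (fe_uniq (h' \o iF : {lrmorphism F -> D})) => x /=; exact: h'F.
Qed.

Section SubalgebraType.
Variables (k : fieldType) (C : algType k) (P : {pred C}).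
Hypothesis P_closed : subalg_closed P.

(** The closure proof is kept as an argument so that instance inference recovers the algebra
    structure from the predicate. *)
Definition subalg_pred (_ : subalg_closed P) := [pred c | P c].
Local Notation S := (subalg_pred P_closed).

Let S_closed : GRing.subsemialg_closed S.
Proof. exact: GRing.subalg_closed_semi P_closed. Qed.

HB.instance Definition _ := GRing.isSubalgClosed.Build k C S S_closed.

Definition subalg_type := {c : C | S c}.
HB.instance Definition _ := SubChoice.on subalg_type.
HB.instance Definition _ := [SubChoice_isSubAlgebra of subalg_type by <:].

Definition subalg_val (c : subalg_type) : C := \val c.

Let subalg_val_linear : linear subalg_val.
Proof. by move=> a u v; rewrite /subalg_val linearP. Qed.
HB.instance Definition _ :=
  GRing.isLinear.Build k subalg_type C _ subalg_val subalg_val_linear.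

Let subalg_val_monoid : monoid_morphism subalg_val.
Proof. by split=> [|u v]; rewrite /subalg_val (rmorph1, rmorphM). Qed.
HB.instance Definition _ :=
  GRing.isMonoidMorphism.Build subalg_type C subalg_val subalg_val_monoid.

End SubalgebraType.

(** The universal property gives a map from [C] to the subalgebra [P]; followed by the inclusion it
    agrees with the identity on generators, so by uniqueness it is the identity. *)
Lemma free_extension_generated (k : fieldType) (T : Type) (B C : algType k)
    (iB : {lrmorphism B -> C}) (xi : T -> C) (P : {pred C}) :
    free_extension iB xi -> subalg_closed P ->
  (forall b, iB b \in P) -> (forall x, xi x \in P) -> forall c, c \in P.
Proof.
move=> univ Pcl PB Px.
pose D := subalg_type Pcl.
pose f0 (b : B) : D := exist _ (iB b) (PB b).
have f0_lin : linear f0 by move=> a u v; apply: val_inj; rewrite /= linearP.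
have f0_mon : monoid_morphism f0.
  by split=> [|u v]; apply: val_inj; rewrite /= (rmorph1, rmorphM).
pose fL := GRing.isLinear.Build _ _ _ _ f0 f0_lin.
pose fM := GRing.isMonoidMorphism.Build _ _ f0 f0_mon.
pose f : {lrmorphism B -> D} := HB.pack f0 fL fM.
have [h [hB hx] _] := univ D f (fun x => exist _ (xi x) (Px x)).
have [g _ g_uniq] := univ C iB xi.
move=> c; have -> : c = val (h c); last exact: (valP (h c)).
rewrite [LHS](g_uniq idfun) //.
rewrite -(g_uniq (@subalg_val _ _ _ Pcl \o h : {lrmorphism C -> C})) //= => [b|x].
  by rewrite hB.
by rewrite hx.
Qed.

(** * Triangular matrices over a bimodule of bilinear maps *)

Section Triangular.
Variables (k : fieldType) (C B : algType k) (V : lmodType k).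

Definition bilinear_fun (f : C -> B -> V) :=
  (forall b, linear (f ^~ b)) /\ (forall c, linear (f c)).

Definition bilinear_pred : {pred C -> B -> V} := [pred f | `[< bilinear_fun f >]].

Let bilinear_closed : GRing.subsemimod_closed bilinear_pred.
Proof.
apply: GRing.submod_closed_semi; split.
  apply/asboolP; split=> [b|c] a u v; first by rewrite scaler0 addr0.
  by rewrite scaler0 addr0.
move=> a f g /asboolP[fl fr] /asboolP[gl gr].
apply/asboolP; split=> [b|c] d u v.
  change (a *: f (d *: u + v) b + g (d *: u + v) b =
    d *: (a *: f u b + g u b) + (a *: f v b + g v b)).
  by rewrite fl gl !scalerDr !scalerA mulrC addrACA.
change (a *: f c (d *: u + v) + g c (d *: u + v) =
    d *: (a *: f c u + g c u) + (a *: f c v + g c v)).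
by rewrite fr gr !scalerDr !scalerA mulrC addrACA.
Qed.

HB.instance Definition _ :=
  GRing.isSubmodClosed.Build k (C -> B -> V) bilinear_pred bilinear_closed.

Definition bilin := {f : C -> B -> V | bilinear_pred f}.
HB.instance Definition _ := SubChoice.on bilin.
HB.instance Definition _ := [SubChoice_isSubLmodule of bilin by <:].

Definition bilin_eval (f : bilin) (c : C) (b : B) : V := \val f c b.
Arguments bilin_eval : simpl never.

Lemma bilinP (f : bilin) : bilinear_fun (bilin_eval f).
Proof. exact/asboolP/(valP f). Qed.

Lemma bilinDl (f : bilin) c1 c2 b :
  bilin_eval f (c1 + c2) b = bilin_eval f c1 b + bilin_eval f c2 b.
Proof. by rewrite -[c1]scale1r (bilinP f).1 !scale1r. Qed.

Lemma bilinDr (f : bilin) c b1 b2 :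
  bilin_eval f c (b1 + b2) = bilin_eval f c b1 + bilin_eval f c b2.
Proof. by rewrite -[b1]scale1r (bilinP f).2 !scale1r. Qed.

Lemma bilin0l (f : bilin) b : bilin_eval f 0 b = 0.
Proof. by apply: (addrI (bilin_eval f 0 b)); rewrite -bilinDl !addr0. Qed.

Lemma bilin0r (f : bilin) c : bilin_eval f c 0 = 0.
Proof. by apply: (addrI (bilin_eval f c 0)); rewrite -bilinDr !addr0. Qed.

Lemma bilinZl (f : bilin) a c b : bilin_eval f (a *: c) b = a *: bilin_eval f c b.
Proof. by have := (bilinP f).1 b a c 0; rewrite !addr0 bilin0l addr0. Qed.

Lemma bilinZr (f : bilin) a c b : bilin_eval f c (a *: b) = a *: bilin_eval f c b.
Proof. by have := (bilinP f).2 c a b 0; rewrite !addr0 bilin0r addr0. Qed.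

Lemma bilin_eq (f g : bilin) :
  (forall c b, bilin_eval f c b = bilin_eval g c b) -> f = g.
Proof. by move=> fg; apply/val_inj/funext=> c; apply/funext=> b. Qed.

Lemma bilin_addE (f g : bilin) c b :
  bilin_eval (f + g) c b = bilin_eval f c b + bilin_eval g c b.
Proof. by rewrite /bilin_eval raddfD. Qed.

Lemma bilin_scaleE a (f : bilin) c b : bilin_eval (a *: f) c b = a *: bilin_eval f c b.
Proof. by rewrite /bilin_eval linearZ. Qed.

Lemma bilin_zeroE c b : bilin_eval (0 : bilin) c b = 0.
Proof. by rewrite /bilin_eval raddf0. Qed.

Let bilin_act_closed (c : C) (f : bilin) (b : B) :
  bilinear_pred (fun c0 b0 => bilin_eval f (c0 * c) (b * b0)).
Proof.
apply/asboolP; split=> [b0|c0] a u v.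
  by rewrite mulrDl -scalerAl bilinDl bilinZl.
by rewrite mulrDr -scalerAr bilinDr bilinZr.
Qed.

Definition bilin_act c f b : bilin :=
  exist (fun f => is_true (bilinear_pred f)) _ (bilin_act_closed c f b).

Lemma bilin_actE c f b c0 b0 :
  bilin_eval (bilin_act c f b) c0 b0 = bilin_eval f (c0 * c) (b * b0).
Proof. by []. Qed.

(* The ring of matrices [[c, f], [0, b]], where the bilinear maps form a
   C-B-bimodule by (c f b)(c0, b0) = f (c0 c, b b0). *)
Definition triangular : Type := (C * bilin * B)%type.
HB.instance Definition _ := GRing.Lmodule.on triangular.

Definition tri_one : triangular := (1, 0, 1).
Definition tri_mul (x y : triangular) : triangular :=
  (x.1.1 * y.1.1, bilin_act x.1.1 y.1.2 1 + bilin_act 1 x.1.2 y.2, x.2 * y.2).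

Lemma tri_eq (x y : triangular) :
  x.1.1 = y.1.1 -> (forall c b, bilin_eval x.1.2 c b = bilin_eval y.1.2 c b) ->
  x.2 = y.2 -> x = y.
Proof. by case: x y => [[? ?] ?] [[? ?] ?] /= -> /bilin_eq -> ->. Qed.

Let tri_mulA : associative tri_mul.
Proof.
move=> x y z; apply: tri_eq => [|c b|] /=; rewrite ?mulrA //.
rewrite !(bilin_addE, bilin_actE) !mulr1 !mul1r !mulrA.
by rewrite addrA.
Qed.

Let tri_mul1l : left_id tri_one tri_mul.
Proof.
move=> x; apply: tri_eq => [|c b|] /=; rewrite ?mul1r //.
by rewrite bilin_addE !bilin_actE bilin_zeroE addr0 mulr1 mul1r.
Qed.

Let tri_mul1r : right_id tri_one tri_mul.
Proof.
move=> x; apply: tri_eq => [|c b|] /=; rewrite ?mulr1 //.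
by rewrite bilin_addE !bilin_actE bilin_zeroE add0r mulr1 mul1r.
Qed.

Let tri_mulDl : left_distributive tri_mul +%R.
Proof.
move=> x y z; apply: tri_eq => [|c b|] /=; rewrite ?mulrDl //.
by rewrite !(bilin_addE, bilin_actE) mulrDr bilinDl addrACA.
Qed.

Let tri_mulDr : right_distributive tri_mul +%R.
Proof.
move=> x y z; apply: tri_eq => [|c b|] /=; rewrite ?mulrDr //.
by rewrite !(bilin_addE, bilin_actE) mulrDl bilinDr addrACA.
Qed.

Let tri_one_neq0 : tri_one != 0.
Proof. by apply/eqP=> /(congr1 snd) /= /eqP; rewrite oner_eq0. Qed.

HB.instance Definition _ := GRing.Zmodule_isNzRing.Build triangular
  tri_mulA tri_mul1l tri_mul1r tri_mulDl tri_mulDr tri_one_neq0.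

Let tri_scaleAl (a : k) (x y : triangular) : a *: (x * y) = (a *: x) * y.
Proof.
apply: tri_eq => [|c b|] /=; rewrite ?scalerAl //.
by rewrite !(bilin_addE, bilin_scaleE, bilin_actE) -scalerAr bilinZl scalerDr.
Qed.

HB.instance Definition _ := GRing.Lmodule_isLalgebra.Build k triangular tri_scaleAl.

Let tri_scaleAr (a : k) (x y : triangular) : a *: (x * y) = x * (a *: y).
Proof.
apply: tri_eq => [|c b|] /=; rewrite ?scalerAr //.
by rewrite !(bilin_addE, bilin_scaleE, bilin_actE) -scalerAl bilinZr scalerDr.
Qed.

HB.instance Definition _ := GRing.Lalgebra_isAlgebra.Build k triangular tri_scaleAr.

End Triangular.

(** Let [h] send [b] to the diagonal matrix with entries [iB b], [b], and [x] to the matrix with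
    first row [xi x], [tau x] and second row 0. Then [Psi c] is the corner entry of [h c] evaluated
    at 1, 1, plus [s] of its lower right entry. Thus linear maps out of [C] can be prescribed
    independently on [B] and on C (x) kX (x) B. *)
Lemma free_extension_rec (k : fieldType) (T : Type) (B C : algType k)
    (iB : {lrmorphism B -> C}) (xi : T -> C) (V : lmodType k)
    (s : {linear B -> V}) (tau : T -> C -> B -> V) :
    free_extension iB xi -> (forall x, bilinear_fun (tau x)) ->
  exists2 Psi : {linear C -> V}, forall b, Psi (iB b) = s b &
    forall x c b, Psi (c * xi x * iB b) = tau x c b.
Proof.
move=> univ tauP; pose D : algType k := triangular C B V.
pose f0 (b : B) : D := (iB b, 0, b).
have f0_lin : linear f0.
  move=> a u v; apply: tri_eq => /= [|c b|]; rewrite ?linearP //.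
  by rewrite bilin_addE bilin_scaleE !bilin_zeroE scaler0 addr0.
have f0_mon : monoid_morphism f0.
  split=> [|u v]; apply: tri_eq => /= [|c b|]; rewrite ?rmorph1 ?rmorphM //.
  by rewrite bilin_addE !bilin_actE !bilin_zeroE addr0.
pose fL := GRing.isLinear.Build _ _ _ _ f0 f0_lin.
pose fM := GRing.isMonoidMorphism.Build _ _ f0 f0_mon.
pose f : {lrmorphism B -> D} := HB.pack f0 fL fM.
have tau_in x : bilinear_pred (tau x) by apply/asboolP.
pose t x : bilin C B V :=
  exist (fun f => is_true (bilinear_pred f)) _ (tau_in x).
have [h [hB hx] _] := univ D f (fun x => (xi x, t x, 0) : D).
(* The upper left entry is an algebra endomorphism of [C] fixing the generators. *)
have hE c : (h c).1.1 = c.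
  have [g _ g_uniq] := univ C iB xi.
  pose p0 (c : C) : C := (h c).1.1.
  have p0_lin : linear p0 by move=> a u v; rewrite /p0 linearP.
  have p0_mon : monoid_morphism p0.
    by split=> [|u v]; rewrite /p0 (rmorph1, rmorphM).
  pose pL := GRing.isLinear.Build _ _ _ _ p0 p0_lin.
  pose pM := GRing.isMonoidMorphism.Build _ _ p0 p0_mon.
  pose p : {lrmorphism C -> C} := HB.pack p0 pL pM.
  rewrite -[LHS]/(p c) -[RHS]/(idfun c) [RHS]g_uniq // g_uniq //.
    by move=> b /=; rewrite /p0 hB.
  by move=> x /=; rewrite /p0 hx.
pose Psi0 c := bilin_eval (h c).1.2 1 1 + s (h c).2.
have Psi_lin : linear Psi0.
  move=> a u v; rewrite /Psi0 !linearP /= bilin_addE bilin_scaleE.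
  by rewrite scalerDr addrACA.
pose PL := GRing.isLinear.Build _ _ _ _ Psi0 Psi_lin.
exists (HB.pack Psi0 PL : {linear C -> V}) => [b|x c b] /=; rewrite /Psi0.
  by rewrite hB /= bilin_zeroE add0r.
have -> : h (c * xi x * iB b) = h c * h (xi x) * h (iB b) by rewrite !rmorphM.
rewrite hB hx /= mulr0 mul0r linear0 addr0.
rewrite !(bilin_addE, bilin_actE) bilin_zeroE add0r !mul0r bilin0r addr0.
by rewrite !mul1r !mulr1 hE.
Qed.

(** The elements preserving [Q] under right multiplication form a subalgebra containing the
    generators, hence all of [C]; apply this to [1 \in Q]. *)
Lemma free_extension_ind (k : fieldType) (T : Type) (B C : algType k)
    (iB : {lrmorphism B -> C}) (xi : T -> C) (Q : {pred C}) :
    free_extension iB xi -> submod_closed Q -> 1 \in Q ->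
    (forall q b, q \in Q -> q * iB b \in Q) ->
    (forall q x, q \in Q -> q * xi x \in Q) ->
  forall c, c \in Q.
Proof.
move=> univ [Q0 Qlin] Q1 QB Qx c.
pose P : {pred C} := [pred c | `[< forall q, q \in Q -> q * c \in Q >]].
suff /asboolP/(_ 1 Q1) : c \in P by rewrite mul1r.
apply: (free_extension_generated univ) c => [|b|x]; last 2 first.
- by apply/asboolP=> q /QB.
- by apply/asboolP=> q /Qx.
split=> [|a u v /asboolP Pu /asboolP Pv|u v /asboolP Pu /asboolP Pv].
- by apply/asboolP=> q; rewrite mulr1.
- apply/asboolP=> q Qq; rewrite mulrDr -scalerAr.
  by apply: Qlin; [exact: Pu | exact: Pv].
- by apply/asboolP=> q Qq; rewrite mulrA; exact/Pv/Pu.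
Qed.

(** * Linear algebra *)

Section LinearAlgebra.
Variable k : fieldType.

(* Zorn's lemma on graphs: adjoining a vector v0 to the domain is possible
   because [f u = v] is only required for v in the image of f. *)
Lemma linear_pinv (U V : lmodType k) (f : {linear U -> V}) :
  exists q : {linear V -> U}, forall u, f (q (f u)) = f u.
Proof.
pose P (G : set (V * U)) := [/\ forall a x y, G x -> G y -> G (a *: x + y),
  forall u, G (0, u) -> u = 0 & forall v u w, G (v, u) -> v = f w -> f u = v].
have [F FP Ftot|G [[Glin G0 Gf] Gmax]] := @Zorn_bigcup (V * U)%type P.
  split=> [a x y [X FX Xx] [Y FY Yy]|u [X FX Xu]|v u w [X FX Xu]].
  - have [XY|YX] := Ftot X Y FX FY.
      by exists Y => //; have [Ylin _ _] := FP _ FY; apply: Ylin => //; apply: XY.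
    by exists X => //; have [Xlin _ _] := FP _ FX; apply: Xlin => //; apply: YX.
  - by have [_ X0 _] := FP _ FX; apply: X0.
  - by have [_ _ Xf] := FP _ FX; apply: Xf Xu.
(* The empty graph satisfies [P], so nonemptiness of [G] has to come from maximality, by comparison
   with the graph reduced to 0. *)
have Gz : G 0.
  have [[x Gx]|GN] := pselect (exists x, G x).
    by have := Glin (-1) _ _ Gx Gx; rewrite scaleN1r addNr.
  exfalso; apply: (Gmax [set 0]).
    by split=> [x Gx|sub]; [case: GN; exists x | apply: GN; exists 0; apply: sub].
  split=> [a x y -> ->|u [->] //|v u w [-> ->] _]; last by rewrite linear0.
  by rewrite scaler0 addr0.
have GZ a x : G x -> G (a *: x) by move=> Gx; have := Glin a x 0 Gx Gz; rewrite addr0.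
have GD x y : G x -> G y -> G (x + y) by move=> Gx Gy; rewrite -[x]scale1r; apply: Glin.
have GB x y : G x -> G y -> G (x - y).
  by move=> Gx Gy; rewrite addrC -scaleN1r; apply: Glin.
have Gdom v0 : exists u, G (v0, u).
  apply: contrapT => Nv0.
  (* The value [u0] is forced modulo the kernel of [f] as soon as one [v1 + v0] lies in the image;
     linearity and [Gf] then settle all other [v]. Otherwise any value will do. *)
  have [u0 u0P] : exists u0, forall v u w, G (v, u) -> v + v0 = f w ->
      f (u + u0) = v + v0.
    have [[[v1 u1] [w1 /= [G1 e1]]]|N] :=
        pselect (exists vu w, G vu /\ vu.1 + v0 = f w); last first.
      by exists 0 => v u w Gvu e; case: N; exists (v, u), w.
    exists (w1 - u1) => v u w Gvu e.
    have e2 : f (u - u1) = v - v1.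
      apply: (Gf _ _ (w - w1)); first exact: (GB (v, u) (v1, u1)).
      by rewrite linearB -e -e1 opprD addrACA subrr addr0.
    by rewrite addrCA linearD e2 -e1 addrC addrA subrK.
  pose H : set (V * U) :=
    [set x | exists2 y, G y & exists c : k, x = y + c *: (v0, u0)].
  apply: (Gmax H).
    split=> [x Gx|sub]; first by exists x => //; exists 0; rewrite scale0r addr0.
    apply: Nv0; exists u0; apply: sub; exists 0 => //; exists 1.
    by rewrite scale1r add0r.
  split=> [a x y [x1 G1 [c1 ->]] [y1 Gy1 [c2 ->]]|u|v u w].
  - exists (a *: x1 + y1); first exact: Glin.
    by exists (a * c1 + c2); rewrite scalerDr scalerDl scalerA addrACA.
  - case=> [[v1 u1] G1 [c [e ->]]]; have [c0|c0] := eqVneq c 0.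
      rewrite c0 !scale0r !addr0 in e *; apply: G0; by rewrite e.
    (* For nonzero [c], the vector [v0] is a multiple of [v1] and so already in the domain of
       [G]. *)
    case: Nv0; exists (- c^-1 *: u1).
    have -> : v0 = - c^-1 *: v1.
      move/esym/eqP: e; rewrite addr_eq0 => /eqP ->.
      by rewrite scalerN scaleNr opprK scalerA mulVf // scale1r.
    exact: (GZ (- c^-1) (v1, u1)).
  - case=> [[v1 u1] G1 [c [-> ->]]] e; have [c0|c0] := eqVneq c 0.
      rewrite c0 !scale0r !addr0 in e *; exact: Gf G1 e.
    apply: (scalerI (invr_neq0 c0)); rewrite -linearZ /= !scalerDr !scalerA.
    rewrite mulVf // !scale1r; apply: (u0P _ _ (c^-1 *: w)).
      exact: (GZ c^-1 (v1, u1)).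
    by rewrite linearZ /= -e scalerDr scalerA mulVf // scale1r.
pose q0 v := sval (cid (Gdom v)).
have Gq v : G (v, q0 v) by exact: svalP (cid (Gdom v)).
have q0E v u : G (v, u) -> q0 v = u.
  move=> Gvu; apply/eqP; rewrite -subr_eq0; apply/eqP/G0.
  by rewrite -(subrr v); apply: (GB (v, q0 v) (v, u)).
have q_lin : linear q0.
  by move=> a u v; apply: q0E; apply: (Glin a (u, _) (v, _)).
pose qL := GRing.isLinear.Build _ _ _ _ q0 q_lin.
by exists (HB.pack q0 qL : {linear V -> U}) => u; exact: Gf (Gq _) erefl.
Qed.

Definition in_span (U : lmodType k) (s : seq U) (p : U) :=
  forall Q : {pred U}, submod_closed Q -> {subset s <= Q} -> p \in Q.

Lemma in_spanE (U : lmodType k) (s : seq U) p : in_span s p ->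
  exists r : 'I_(size s) -> k, p = \sum_i r i *: s`_i.
Proof.
move=> sp; pose Q : {pred U} := [pred p | `[< exists r : 'I_(size s) -> k,
  p = \sum_i r i *: s`_i >]].
suff /asboolP : p \in Q by [].
apply: sp => [|v vs].
  split=> [|a u v /asboolP[r ->] /asboolP[t ->]]; apply/asboolP.
    by exists (fun=> 0); rewrite big1 // => i _; rewrite scale0r.
  exists (fun i => a * r i + t i); rewrite scaler_sumr -big_split /=.
  by apply: eq_bigr => i _; rewrite scalerDl scalerA.
apply/asboolP; have vs' : (index v s < size s)%N by rewrite index_mem.
exists (fun i => (i == Ordinal vs')%:R); rewrite (bigD1 (Ordinal vs')) //=.
rewrite eqxx scale1r nth_index // big1 ?addr0 // => i /negbTE ->.
by rewrite scale0r.
Qed.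

(* A minimal spanning family is a basis, on which both theta and a choice of
   preimages are given by square matrices. *)
Lemma surjective_injective (U : lmodType k) (P : set U) (theta : {linear U -> U})
    (m : nat) (v : 'I_m -> U) :
    (forall i, P (v i)) ->
    (forall p, P p -> exists r : 'I_m -> k, p = \sum_i r i *: v i) ->
    (forall p, P p -> P (theta p)) ->
    (forall p, P p -> exists2 p', P p' & theta p' = p) ->
  forall p, P p -> theta p = 0 -> p = 0.
Proof.
move=> Pv vP thetaP thetaS.
pose S m := `[< exists v : 'I_m -> U, (forall i, P (v i)) /\
  forall p, P p -> exists r : 'I_m -> k, p = \sum_i r i *: v i >].
have exS : exists m, S m by exists m; apply/asboolP; exists v.
have [{}m /asboolP[{Pv vP}v [Pv vP]] m_min] := ex_minnP exS.
have v_free (r : 'I_m -> k) : \sum_i r i *: v i = 0 -> forall i, r i = 0.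
  move=> r0 i; apply: contrapT => /eqP ri.
  case: m i v Pv vP m_min r r0 ri => [[]//|m] i v Pv vP m_min r r0 ri.
  (* A relation with [r i] nonzero allows [v i] to be eliminated, against minimality of the
     length. *)
  suff /m_min : S m by rewrite ltnn.
  apply/asboolP; exists (v \o lift i); split=> [j|p /vP[t ->]]; first exact: Pv.
  exists (fun j => t (lift i j) - t i / r i * r (lift i j)).
  have -> : \sum_i t i *: v i = \sum_i t i *: v i - (t i / r i) *: (\sum_i r i *: v i).
    by rewrite r0 scaler0 subr0.
  rewrite !(bigD1_ord i) //= scalerDr scaler_sumr opprD addrACA.
  rewrite scalerA divfK // subrr add0r -sumrB; apply: eq_bigr => j _.
  by rewrite scalerBl scalerA.
pose c (r : 'rV[k]_m) := \sum_i r 0 i *: v i.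
have c_inj r t : c r = c t -> r = t.
  move=> e; apply/rowP=> i; apply/eqP; rewrite -subr_eq0; apply/eqP.
  apply: (v_free (fun i => r 0 i - t 0 i)).
  under eq_bigr do rewrite scalerBl.
  by rewrite sumrB -/(c r) -/(c t) e subrr.
have coord p : P p -> exists r, p = c r.
  move=> /vP[r ->]; exists (\row_i r i); apply: eq_bigr => i _; by rewrite mxE.
have cM n r (M : 'M_(n, m)) : c (r *m M) = \sum_i r 0 i *: c (row i M).
  rewrite /c; under [RHS]eq_bigr do rewrite scaler_sumr.
  rewrite exchange_big /=; apply: eq_bigr => j _; rewrite mxE scaler_suml.
  by apply: eq_bigr => i _; rewrite mxE scalerA.
have [N NE] : exists N : 'M_m, forall i, theta (v i) = c (row i N).
  have /choice[n nE] i : exists r, theta (v i) = c r by apply/coord/thetaP/Pv.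
  by exists (\matrix_i n i) => i; rewrite rowK.
have [M ME] : exists M : 'M_m, forall i, theta (c (row i M)) = v i.
  have /choice[n nE] i : exists r, theta (c r) = v i.
    by have [p /coord[r ->] <-] := thetaS _ (Pv i); exists r.
  by exists (\matrix_i n i) => i; rewrite rowK.
have thetaN r : theta (c r) = c (r *m N).
  by rewrite cM linear_sum; apply: eq_bigr => i _; rewrite linearZ /= NE.
have MN : M *m N = 1%:M.
  apply/row_matrixP=> i; apply: c_inj; rewrite row_mul -thetaN ME rowE mulmx1.
  rewrite /c (bigD1 i) //= mxE !eqxx scale1r big1 ?addr0 // => j ji.
  by rewrite mxE (negbTE ji) andbF scale0r.
move=> p /coord[r ->]; rewrite thetaN => e.
have /(congr1 (mulmx^~ M)) : r *m N = 0.
  by apply: c_inj; rewrite e /c big1 // => i _; rewrite mxE scale0r.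
(* Finite dimension enters here: for square matrices [M *m N = 1] forces [N *m M = 1]. *)
rewrite -mulmxA (mulmx1C MN) mulmx1 mul0mx => ->.
by rewrite /c big1 // => i _; rewrite mxE scale0r.
Qed.

End LinearAlgebra.

(** * Homogeneous components *)

Section Grading.
Variables (k : fieldType) (A : algType k) (gr : nat -> set A).
Hypothesis grA : grading gr.

Lemma gr0 n : gr n 0.
Proof. by case: grA => /(_ n)[+ _] _ _ _ _; rewrite inE. Qed.

Lemma grZD n (c : k) a b : gr n a -> gr n b -> gr n (c *: a + b).
Proof.
move=> ga gb; case: grA => /(_ n)[_ /(_ c a b)] + _ _ _ _.
by rewrite !inE; apply.
Qed.

Lemma grD n a b : gr n a -> gr n b -> gr n (a + b).
Proof. by move=> ga gb; rewrite -[a]scale1r; apply: grZD. Qed.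

Lemma grZ n (c : k) a : gr n a -> gr n (c *: a).
Proof. by move=> ga; rewrite -[_ *: _]addr0; apply: grZD => //; apply: gr0. Qed.

Lemma grN n a : gr n a -> gr n (- a).
Proof. by rewrite -scaleN1r; apply: grZ. Qed.

Lemma grB n a b : gr n a -> gr n b -> gr n (a - b).
Proof. by move=> ga gb; apply: grD => //; apply: grN. Qed.

Lemma gr_sum n (I : Type) (r : seq I) (P : pred I) (F : I -> A) :
  (forall i, P i -> gr n (F i)) -> gr n (\sum_(i <- r | P i) F i).
Proof.
by move=> grF; elim/big_ind: _ => //; [exact: gr0 | move=> *; exact: grD].
Qed.

Lemma gr1 : gr 0 1. Proof. by case: grA. Qed.

Lemma grM m n a b : gr m a -> gr n b -> gr (m + n)%N (a * b).
Proof. by case: grA => _ _ + _ _; apply. Qed.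

(** A decomposition into homogeneous components is recorded as a polynomial with the component of
    degree i as coefficient of X^i. Evaluation at 1 recovers the element, and products of
    decompositions become products of polynomials. *)
Definition homogeneous_poly (p : {poly A}) := forall i, gr i p`_i.

Lemma homogeneous_polyM p q :
  homogeneous_poly p -> homogeneous_poly q -> homogeneous_poly (p * q).
Proof.
move=> hp hq i; rewrite coefM; apply: gr_sum => j _.
by rewrite -[X in gr X](@subnKC j) -1?ltnS //; apply: grM.
Qed.

Lemma homogeneous_poly_inj p q :
  homogeneous_poly p -> homogeneous_poly q -> p.[1] = q.[1] -> p = q.
Proof.
move=> hp hq; set n := maxn (size p) (size q).
rewrite (@horner_coef_wide _ n p) ?leq_maxl //.
rewrite (@horner_coef_wide _ n q) ?leq_maxr //.
under eq_bigr do rewrite expr1n mulr1.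
under [X in _ = X]eq_bigr do rewrite expr1n mulr1.
move=> /eqP; rewrite -subr_eq0 -sumrB => /eqP e.
case: grA => _ _ _ _ /(_ n (fun i => p`_i - q`_i)) uniq.
have {e}/uniq uniq := e.
apply/polyP=> i; apply/eqP; rewrite -subr_eq0; apply/eqP.
have [lin|ni] := ltnP i n; first by apply: uniq => // j; apply: grB.
by rewrite !nth_default ?subrr // (leq_trans _ ni) // ?leq_maxl ?leq_maxr.
Qed.

Lemma homogeneous_poly_exists a : exists p, homogeneous_poly p /\ p.[1] = a.
Proof.
case: grA => _ _ _ /(_ a)[n [u [gu ->]]] _; exists (\poly_(i < n) u i); split.
  by move=> i; rewrite coef_poly; case: ifP => // _; apply: gr0.
by rewrite horner_poly; apply: eq_bigr => i _; rewrite expr1n mulr1.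
Qed.

(* The coaction A -> A[t] defining the grading; it is a ring morphism. *)
Definition gpoly a : {poly A} := sval (cid (homogeneous_poly_exists a)).

Lemma gpolyP a : homogeneous_poly (gpoly a).
Proof. by rewrite /gpoly; case: cid => p []. Qed.

Lemma gpoly1 a : (gpoly a).[1] = a.
Proof. by rewrite /gpoly; case: cid => p []. Qed.

Lemma gpolyE p a : homogeneous_poly p -> p.[1] = a -> gpoly a = p.
Proof.
by move=> hp e; apply: homogeneous_poly_inj => //; [apply: gpolyP|rewrite gpoly1].
Qed.

Lemma gpolyM a b : gpoly (a * b) = gpoly a * gpoly b.
Proof.
apply: gpolyE; first by apply: homogeneous_polyM; apply: gpolyP.
by rewrite hornerM_comm ?gpoly1 // /comm_poly gpoly1 mulr1 mul1r.
Qed.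

Lemma gpoly_homogeneous n a : gr n a -> gpoly a = a%:P * 'X^n.
Proof.
move=> ga; apply: gpolyE => [i|]; last first.
  by rewrite mul_polyC hornerZ horner_exp_comm ?/comm_poly hornerX ?expr1n ?mulr1.
rewrite coefMXn; case: ltnP => [_|ni]; first exact: gr0.
rewrite coefC subn_eq0; case: leqP => [iN|_]; last exact: gr0.
by have -> : i = n by apply/eqP; rewrite eqn_leq iN.
Qed.

Definition gcomp n a := (gpoly a)`_n.

Lemma gcompP n a : gr n (gcomp n a).
Proof. exact: gpolyP. Qed.

Let gcomp_linear n : linear (gcomp n).
Proof.
move=> c a b; rewrite /gcomp (_ : gpoly _ = c%:A *: gpoly a + gpoly b).
  by rewrite coefD coefZ mulr_algl.
apply: gpolyE => [i|]; last by rewrite hornerD hornerZ !gpoly1 mulr_algl.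
by rewrite coefD coefZ mulr_algl; apply: grZD; apply: gpolyP.
Qed.

HB.instance Definition _ n := GRing.isLinear.Build k A A _ (gcomp n) (gcomp_linear n).

Lemma gcomp_sum n a : (size (gpoly a) <= n)%N -> a = \sum_(i < n) gcomp i a.
Proof.
move=> le; rewrite -{1}[a]gpoly1 (horner_coef_wide _ le).
by apply: eq_bigr => i _; rewrite expr1n mulr1.
Qed.

Lemma gcompE a : a = \sum_(i < size (gpoly a)) gcomp i a.
Proof. exact: gcomp_sum. Qed.

Lemma gcomp_default n a : (size (gpoly a) <= n)%N -> gcomp n a = 0.
Proof. exact: nth_default. Qed.

Lemma gcomp_id n m a : gr n a -> gcomp m a = if m == n then a else 0.
Proof.
move=> ga; rewrite /gcomp (gpoly_homogeneous ga) coefMXn coefC subn_eq0.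
by case: ltngtP.
Qed.

Lemma gcompMr d n a b : gr d b ->
  gcomp n (a * b) = if (n < d)%N then 0 else gcomp (n - d) a * b.
Proof.
move=> gb; rewrite /gcomp gpolyM (gpoly_homogeneous gb) mulrA coefMXn.
by rewrite coefMC.
Qed.

Lemma gcompMl d n a b : gr d a ->
  gcomp n (a * b) = if (n < d)%N then 0 else a * gcomp (n - d) b.
Proof.
move=> ga; rewrite /gcomp gpolyM (gpoly_homogeneous ga) -mulrA.
by rewrite -(commr_polyXn (gpoly b)) mulrA coefMXn coefCM.
Qed.

Lemma homogeneousP (J : set A) :
  (forall a b, J a -> J b -> J (a + b)) -> J 0 ->
  homogeneous gr J <-> forall a, J a -> forall n, J (gcomp n a).
Proof.
move=> JD J0; split=> [hJ a Ja n|hJ n u gu Ju i lin].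
  have [lt|ge] := ltnP n (size (gpoly a)); last by rewrite gcomp_default.
  apply: (hJ (size (gpoly a)) (gcomp^~ a)) => // [i|]; first exact: gcompP.
  by rewrite -gcomp_sum.
suff -> : u i = gcomp i (\sum_(i < n) u i) by apply: hJ.
rewrite linear_sum (bigD1 (Ordinal lin)) //= (gcomp_id _ (gu i)) eqxx.
rewrite big1 ?addr0 // => j ji; rewrite (gcomp_id _ (gu j)).
by rewrite eq_sym ifN.
Qed.

(** The elements all of whose components lie in (X) form a two-sided ideal, as components of a
    product are sums of products of components; it contains X. *)
Lemma ideal_gen_homogeneous (X : set A) a :
    X `<=` homogeneous_elements gr -> ideal_gen X a ->
  forall n, ideal_gen X (gcomp n a).
Proof.
move=> Xh; set J : set A := [set a | forall n, ideal_gen X (gcomp n a)].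
have I_ideal : two_sided_ideal (ideal_gen X).
  split=> [|r b Ib Y YP]; last by have [[_ YL] _] := YP; exact: (YL r b (Ib Y YP)).
  split=> [Y [[[Y0 _ _] _] _] //|b c Ib Ic Y YP|b r Ib Y YP].
    by have [[[_ YD _] _] _] := YP; exact: (YD b c (Ib Y YP) (Ic Y YP)).
  by have [[[_ _ YM] _] _] := YP; exact: (YM b r (Ib Y YP)).
have [[I0 ID IM] IL] := I_ideal.
have Isum n (F : 'I_n -> A) : (forall i, ideal_gen X (F i)) ->
    ideal_gen X (\sum_i F i).
  by move=> IF; elim/big_ind: _ => //; exact: ID.
apply: (@smallest_sub _ (@two_sided_ideal A) X J).
  split; first split=> [n|b c Jb Jc n|b r Jb n].
  - by rewrite linear0.
  - by rewrite linearD; exact: ID (Jb n) (Jc n).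
  - rewrite /gcomp gpolyM coefM; apply: (Isum _ _) => i; exact: IM (Jb _).
  - move=> r b Jb n; rewrite /gcomp gpolyM coefM.
    by apply: (Isum _ _) => i; exact: IL (Jb _).
move=> x Xx n; have [d _ gx] := Xh _ Xx; rewrite (gcomp_id _ gx).
by case: eqP => _; [apply: sub_gen_smallest | exact: I0].
Qed.

End Grading.

(** * Finite-dimensional components and graded sections *)

Lemma in_span0 (k : fieldType) (U : lmodType k) (s : seq U) : in_span s 0.
Proof. by move=> Q []. Qed.

Lemma in_spanZD (k : fieldType) (U : lmodType k) (s : seq U) c u v :
  in_span s u -> in_span s v -> in_span s (c *: u + v).
Proof. by move=> su sv Q Qs sQ; apply: Qs.2; [apply: su | apply: sv]. Qed.

Lemma in_span_mem (k : fieldType) (U : lmodType k) (s : seq U) v :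
  v \in s -> in_span s v.
Proof. by move=> vs Q _; apply. Qed.

(** The subspace k + sum of A p for p in [t]. It will be all of A, for a family [t] of homogeneous
    elements of positive degree; the first entry of each pair is that degree. *)
Inductive generated_left (k : fieldType) (A : algType k) (t : seq (nat * A)) :
    A -> Prop :=
| generated_scalar c : generated_left t c%:A
| generated_add u v :
    generated_left t u -> generated_left t v -> generated_left t (u + v)
| generated_mul b p : p \in t -> generated_left t (b * p.2).

(** With [t] the positive degree components of the algebra generators, A = k + sum of A p. So A_n is
    spanned by 1 (for n = 0) and by the products of A_(n - deg p) with p, which are
    finite-dimensional by induction. *)
Lemma graded_finite (k : fieldType) (A : algType k) (gr : nat -> set A) n :
  graded_algebra gr -> exists s : seq A, forall a, gr n a -> in_span s a.
Proof.
case=> grA connA [s sA].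
(* The range starts at 1, since the components of degree 0 are scalars by connectedness. *)
pose t := [seq (i, gcomp grA i e) | e <- s, i <- iota 1 (size (gpoly grA e))].
have tP p : p \in t -> (0 < p.1)%N /\ gr p.1 p.2.
  move=> /allpairsPdep[e [i [es]]]; rewrite mem_iota => /andP[i0 _] -> /=.
  by split=> //; apply: gcompP.
have genZ (c : k) u : generated_left t u -> generated_left t (c *: u).
  elim=> [c1|v w _ Gv _ Gw|b p pt]; first by rewrite scalerA; constructor.
    by rewrite scalerDr; apply: generated_add.
  by rewrite scalerAl; apply: generated_mul.
have gen a : generated_left t a.
  pose S : set A := [set a | generated_left t a].
  suff sub : smallest (fun S : set A => subalg_closed (mem S)) [set` s] `<=` S.
    by apply: sub; rewrite sA.
  apply: smallest_sub => [|e /= es].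
    split=> [|c u v|u v]; rewrite !inE /S /=.
    - by rewrite -[1]scale1r; constructor.
    - by move=> Gu Gv; apply: generated_add => //; apply: genZ.
    - move=> Gu; elim=> [c|w z _ Gw _ Gz|b p pt].
      + by rewrite mulr_algr; apply: genZ.
      + by rewrite mulrDr; apply: generated_add.
      + by rewrite mulrA; apply: generated_mul.
  have G0 : generated_left t 0 by rewrite -[0](scale0r 1); constructor.
  rewrite /S /= [e](gcompE grA).
  elim/big_ind: _ => // [|[[|i] /= lti] _]; first by move=> *; apply: generated_add.
    by have := gcompP grA 0 e; rewrite connA => -[c _ <-]; constructor.
  rewrite -[gcomp _ _ _]mul1r -[gcomp _ _ _]/((i.+1, gcomp grA i.+1 e).2).
  apply: generated_mul.
  apply: (@allpairs_f_dep _ _ _ (fun e i => (i, gcomp grA i e))) => //.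
  by rewrite mem_iota add1n ltnS /= ltnW.
elim/ltn_ind: n => n IH.
have /choice[L LP] m : exists s, (m < n)%N -> forall a, gr m a -> in_span s a.
  by case: (ltnP m n) => [/IH[r rP]|_]; [exists r | exists [::]].
(* The family may contain vectors outside degree n: 1, or those arising when [p.1] exceeds n and the
   difference is truncated to 0. [in_span] allows this. *)
pose M := 1 :: flatten [seq [seq z * p.2 | z <- L (n - p.1)%N] | p <- t].
exists M => a ga.
suff : in_span M (gcomp grA n a) by rewrite (gcomp_id _ _ ga) eqxx.
elim: (gen a) => [c|u v _ Mu _ Mv|b p pt].
- rewrite linearZ /= (gcomp_id _ _ (gr1 grA)) -[_ *: _]addr0.
  apply: in_spanZD; last exact: in_span0.
  by case: eqP => _; [apply/in_span_mem/mem_head | apply: in_span0].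
- by rewrite linearD /= -[gcomp _ _ u]scale1r; apply: in_spanZD.
have [p0 gp] := tP _ pt; rewrite (gcompMr _ _ _ gp).
case: ltnP => [_|pn]; first exact: in_span0.
move=> Q [Q0 Qlin] MQ.
apply: (LP (n - p.1)%N _ _ (gcompP grA _ b) [pred z | z * p.2 \in Q]).
- by rewrite ltn_subrL p0 (leq_trans p0).
- split=> [|c u v]; rewrite !inE ?mul0r // => Qu Qv.
  by rewrite mulrDl -scalerAl; apply: Qlin.
move=> z zL; rewrite inE; apply: MQ; rewrite inE; apply/orP; right.
by apply/flattenP; exists [seq z * p.2 | z <- L (n - p.1)%N]; apply: map_f.
Qed.

(** Any linear section [q] becomes graded by setting s(b) to the sum over i of the degree i
    component of q(b_i), where b_i = [pi (gcomp grA i (q b))] is the degree i part of b. Homogeneity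
    of the kernel makes b_i independent of the preimage of b. *)
Lemma graded_section (k : fieldType) (A B : algType k) (gr : nat -> set A)
    (grA : grading gr) (pi : {lrmorphism A -> B}) :
    range pi = setT -> (forall n a, pi a = 0 -> pi (gcomp grA n a) = 0) ->
  exists2 s : {linear B -> A}, forall b, pi (s b) = b &
    forall n b, quotient_grading gr pi n b -> gr n (s b).
Proof.
move=> pi_surj pi0; have [q qP] := linear_pinv pi.
have piq b : pi (q b) = b.
  by have : setT b by []; rewrite -pi_surj => -[a _ <-]; apply: qP.
have pi_comp n b a : pi a = b -> pi (gcomp grA n (q b)) = pi (gcomp grA n a).
  move=> e; apply/eqP; rewrite -subr_eq0 -!linearB; apply/eqP/pi0.
  by rewrite linearB /= piq e subrr.
pose t i b := gcomp grA i (q (pi (gcomp grA i (q b)))).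
have t_lin i c u v : t i (c *: u + v) = c *: t i u + t i v by rewrite /t !linearP.
pose N b := size (gpoly grA (q b)).
pose s0 b := \sum_(i < N b) t i b.
(* The number of summands depends on [b]; linearity needs a common bound. *)
have s0E b M : (N b <= M)%N -> s0 b = \sum_(i < M) t i b.
  move=> le; rewrite /s0 (big_ord_widen M (t^~ b) le) big_mkcond /=.
  apply: eq_bigr => i _; case: ltnP => // Ni.
  by rewrite /t (gcomp_default Ni) !linear0.
have s_lin : linear s0.
  move=> c u v; pose M := (N (c *: u + v)%R + (N u + N v))%N.
  rewrite (s0E _ M) ?leq_addr // (s0E u M); last by rewrite /M addnCA leq_addr.
  rewrite (s0E v M); last by rewrite /M addnA leq_addl.
  by rewrite scaler_sumr -big_split; apply: eq_bigr => i _; rewrite t_lin.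
pose sL := GRing.isLinear.Build _ _ _ _ s0 s_lin.
exists (HB.pack s0 sL : {linear B -> A}) => [b|n b [a ga e]] /=.
  rewrite linear_sum -[RHS]piq [in RHS](gcompE grA (q b)) linear_sum.
  apply: eq_bigr => i _; rewrite /t /= (pi_comp i (pi _) (gcomp grA i (q b)) erefl).
  by rewrite (gcomp_id _ _ (gcompP grA i _)) eqxx.
have tn i : t i b = if i == n then gcomp grA n (q b) else 0.
  rewrite /t (pi_comp _ _ _ e) (gcomp_id _ _ ga).
  by case: eqP => [->|_]; rewrite ?e ?linear0.
rewrite /s0; apply: gr_sum => // i _; rewrite tn.
by case: eqP => _; [apply: gcompP | apply: gr0].
Qed.

(** Spans in each degree are inductive, so that statements on homogeneous elements can be reduced to
    terms by induction. *)
Inductive graded_span (k : fieldType) (E : lmodType k) (P : nat -> E -> Prop) :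
    nat -> E -> Prop :=
| graded_span0 n : graded_span P n 0
| graded_spanZD n c u v :
    graded_span P n u -> graded_span P n v -> graded_span P n (c *: u + v)
| graded_span_mem n u : P n u -> graded_span P n u.

(** * Freeness of the ideal *)

Section RelativeCompleteIntersection.
Variables (k : fieldType) (A : algType k) (gr : nat -> set A).
Hypothesis gradedA : graded_algebra gr.
Variables (X : set A) (B : algType k) (pi : {lrmorphism A -> B}).
Hypothesis X_homogeneous : X `<=` homogeneous_elements gr.
Hypothesis quot : quotient_map pi (ideal_gen X).

Let grA : grading gr. Proof. by case: gradedA. Qed.

Lemma kernelP a : pi a = 0 <-> ideal_gen X a.
Proof. case: quot => _ <-; exact: iff_refl. Qed.

Lemma generator_in_kernel x : X x -> pi x = 0.
Proof. by move=> Xx; apply/kernelP; exact: (sub_gen_smallest Xx). Qed.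

Lemma kernel_gcomp n a : pi a = 0 -> pi (gcomp grA n a) = 0.
Proof. by move/kernelP => Ia; apply/kernelP; apply: ideal_gen_homogeneous. Qed.

Lemma kernel_degree0 a : gr 0 a -> pi a = 0 -> a = 0.
Proof.
case: gradedA => _ -> _ [c _ <-]; rewrite linearZ /= rmorph1 => /eqP.
by rewrite scaler_eq0 oner_eq0 orbF => /eqP ->; rewrite scale0r.
Qed.

Lemma generator_degree x : X x -> exists2 d, (0 < d)%N & gr d x.
Proof.
move=> Xx; have [[|d] _ gx] := X_homogeneous Xx; last by exists d.+1.
(* A generator of degree 0 would be zero, and zero has every degree. *)
exists 1%N => //; rewrite (kernel_degree0 gx (generator_in_kernel Xx)).
exact: gr0.
Qed.

Lemma quotient_gradingM m n b c : quotient_grading gr pi m b ->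
  quotient_grading gr pi n c -> quotient_grading gr pi (m + n) (b * c).
Proof.
move=> [a ga <-] [a' ga' <-]; exists (a * a'); first exact: grM.
by rewrite rmorphM.
Qed.

Lemma quotient_grading1 : quotient_grading gr pi 0 1.
Proof. by exists 1; [exact: gr1 | rewrite rmorph1]. Qed.

Variable s : {linear B -> A}.
Hypothesis sK : forall b, pi (s b) = b.
Hypothesis s_gr : forall n b, quotient_grading gr pi n b -> gr n (s b).

(** The future images under psi of the terms b and c x b of [C], for which [free_term] is the
    counterpart. *)
Definition standard_term n e :=
  (exists2 b, quotient_grading gr pi n b & e = s b) \/
  exists i d j a x b, [/\ gr i a, X x, gr d x, quotient_grading gr pi j b &
    n = (i + d + j)%N /\ e = a * x * s b].

Lemma standard_span_mull i d j a x e :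
    gr i a -> X x -> gr d x -> graded_span standard_term j e ->
  graded_span standard_term (i + d + j) (a * x * e).
Proof.
move=> ga Xx gx; elim=> {j e} [j|j c u v _ IHu _ IHv|j e].
- by rewrite mulr0; apply: graded_span0.
- by rewrite mulrDr -scalerAr; apply: graded_spanZD.
case=> [[b gb ->]|[i' [d' [j' [a' [x' [b [ga' Xx' gx' gb [-> ->]]]]]]]]].
  by apply/graded_span_mem; right; exists i, d, j, a, x, b.
apply/graded_span_mem; right; exists (i + d + i')%N, d', j', (a * x * a'), x', b.
split=> //; first by do 2!apply: grM => //.
by split; [lia | rewrite !mulrA].
Qed.

(** The difference of a and s(pi a) lies in I, which is spanned by the products l x r. As x has
    positive degree, r has degree less than n and is by induction a combination of standard terms;
    multiplying these on the left by l x keeps them standard. *)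
Lemma standard_span n a : gr n a -> graded_span standard_term n a.
Proof.
elim/ltn_ind: n a => n IH a ga.
have spanI y : pi y = 0 -> graded_span standard_term n (gcomp grA n y).
  pose S := graded_span standard_term n.
  have SD u v : S u -> S v -> S (u + v).
    by move=> Su Sv; rewrite -[u]scale1r; apply: graded_spanZD.
  (* Quantifying over both factors turns the claim on I into an ideal containing X. *)
  pose J : set A := [set y | forall l r, S (gcomp grA n (l * y * r))].
  suff JI : ideal_gen X `<=` J.
    by move=> /kernelP/JI/(_ 1 1); rewrite mul1r mulr1.
  apply: (@smallest_sub _ (@two_sided_ideal A) X J) => [|x Xx l r].
    split; first split.
    - by move=> l r; rewrite mulr0 mul0r linear0; apply: graded_span0.
    - move=> u v Ju Jv l r; rewrite mulrDr mulrDl linearD; exact: SD (Ju l r) (Jv l r).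
    - by move=> u r' Ju l r; rewrite mulrA -mulrA; exact: (Ju l (r' * r)).
    - by move=> l' u Ju l r; rewrite mulrA; exact: (Ju (l * l') r).
  have [d d0 gx] := generator_degree Xx.
  rewrite [l](gcompE grA) [r in _ * r](gcompE grA).
  rewrite !mulr_suml linear_sum; apply: (big_ind S) => // [|i _].
    exact: graded_span0.
  rewrite mulr_sumr linear_sum; apply: (big_ind S) => // [|j _].
    exact: graded_span0.
  have gl := gcompP grA i l; have gr_r := gcompP grA j r.
  rewrite /= (gcomp_id _ _ (grM grA (grM grA gl gx) gr_r)).
  case: eqP => [e|_]; last exact: graded_span0.
  rewrite /S e; apply: standard_span_mull => //; apply: IH => //.
  by lia.
have gsa : gr n (s (pi a)) by apply: s_gr; exists a.
rewrite -[a](subrK (s (pi a))) -[a - _]scale1r; apply: graded_spanZD.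
  rewrite -[a - _](_ : gcomp grA n (a - s (pi a)) = _).
    by apply: spanI; rewrite linearB /= sK subrr.
  by rewrite (gcomp_id _ _ (grB grA ga gsa)) eqxx.
by apply/graded_span_mem; left; exists (pi a) => //; exists a.
Qed.

Variables (C : algType k) (grC : nat -> set C) (phi : {linear C -> A}).
Variables (iB : {lrmorphism B -> C}) (xi : X -> C).
Hypothesis univ : free_extension iB xi.
Hypothesis gradC : grading grC.
Hypothesis iB_gr : forall n b, quotient_grading gr pi n b -> grC n (iB b).
Hypothesis xi_gr : forall n (x : X), gr n (val x) -> grC n (xi x).
Hypothesis phi_bij : bijective phi.
Hypothesis phi_gr : forall n c, grC n c <-> gr n (phi c).

Definition free_term n e :=
  (exists2 b, quotient_grading gr pi n b & e = iB b) \/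
  exists i d j c x b, [/\ grC i c, gr d (val x), quotient_grading gr pi j b &
    n = (i + d + j)%N /\ e = c * xi x * iB b].

Lemma free_span_mulr m n e b : graded_span free_term m e ->
  quotient_grading gr pi n b -> graded_span free_term (m + n) (e * iB b).
Proof.
move=> + gb; elim=> {m e} [m|m c u v _ IHu _ IHv|m e].
- by rewrite mul0r; apply: graded_span0.
- by rewrite mulrDl -scalerAl; apply: graded_spanZD.
case=> [[b' gb' ->]|[i [d [j [c [x [b' [gc gx gb' [-> ->]]]]]]]]].
  apply/graded_span_mem; left; exists (b' * b); last by rewrite rmorphM.
  exact: quotient_gradingM.
apply/graded_span_mem; right; exists i, d, (j + n)%N, c, x, (b' * b).
split=> //; first exact: quotient_gradingM.
by rewrite addnA rmorphM !mulrA.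
Qed.

(** Having all components in the span is preserved by right multiplication by generators: [B] is
    absorbed into the last factor of a term, and c x is itself a term with b = 1. *)
Lemma free_span n c : grC n c -> graded_span free_term n c.
Proof.
move=> gc; suff: graded_span free_term n (gcomp gradC n c).
  by rewrite (gcomp_id _ _ gc) eqxx.
move: n {gc}; pose Q : {pred C} :=
  [pred c | `[< forall n, graded_span free_term n (gcomp gradC n c) >]].
suff /asboolP : c \in Q by [].
apply: (free_extension_ind univ) c => [||q b|q x].
- split=> [|a u v /asboolP Su /asboolP Sv]; apply/asboolP=> n.
    by rewrite linear0; apply: graded_span0.
  by rewrite linearP; apply: graded_spanZD.
- apply/asboolP=> n; rewrite (gcomp_id _ _ (gr1 gradC)).
  case: eqP => [->|_]; last exact: graded_span0.
  apply/graded_span_mem; left; exists 1; last by rewrite rmorph1.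
  exact: quotient_grading1.
- move=> /asboolP Sq; apply/asboolP=> n.
  have [a _ <-] : range pi b by case: quot => -> _.
  rewrite [a](gcompE grA) linear_sum linear_sum mulr_sumr linear_sum.
  elim/big_ind: _ => [|u v Su Sv|j _]; first exact: graded_span0.
    by rewrite -[u]scale1r; apply: graded_spanZD.
  have gj : quotient_grading gr pi j (pi (gcomp grA j a)).
    by exists (gcomp grA j a) => //; apply: gcompP.
  rewrite /= (gcompMr _ _ _ (iB_gr gj)); case: ltnP => [_|jn].
    exact: graded_span0.
  by rewrite -{1}(subnK jn); apply: free_span_mulr.
move=> /asboolP Sq; apply/asboolP=> n.
have [d _ gx] := generator_degree (set_valP x).
rewrite (gcompMr _ _ _ (xi_gr gx)); case: ltnP => [_|dn].
  exact: graded_span0.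
apply/graded_span_mem; right; exists (n - d)%N, d, 0%N, (gcomp gradC (n - d) q), x, 1.
split=> //; [exact: gcompP|exact: quotient_grading1|].
by rewrite rmorph1 mulr1 addn0 subnK.
Qed.

(** [free_span] shows that psi is graded and [standard_span] that it is onto in each degree.
    Composed with the inverse of [phi] it is a surjective endomorphism of the finite-dimensional
    space A_n, hence injective there. *)
Lemma comparison_map : exists psi : {linear C -> A}, [/\ injective psi,
  forall b, psi (iB b) = s b, forall x c b, psi (c * xi x * iB b) = phi c * val x * s b
  & forall a, exists c, psi c = a].
Proof.
have [phi' phiK phi'K] := phi_bij.
have phi'_lin : linear phi' by exact: can2_linear phiK phi'K.
pose pL := GRing.isLinear.Build _ _ _ _ phi' phi'_lin.
pose phiI : {linear A -> C} := HB.pack phi' pL.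
have tau_bilin (x : X) : bilinear_fun (fun c b => phi c * val x * s b).
  split=> [b a u v|c a u v]; first by rewrite linearP !mulrDl -!scalerAl.
  by rewrite linearP mulrDr -scalerAr.
have [psi psiB psiX] := free_extension_rec s univ tau_bilin.
have psi_gr n c : grC n c -> gr n (psi c).
  move/free_span; elim=> {n c} [n|n c u v _ IHu _ IHv|n e].
  - by rewrite linear0; apply: gr0.
  - by rewrite linearP; apply: grZD.
  case=> [[b gb ->]|[i [d [j [c [x [b [gc gx gb [-> ->]]]]]]]]].
    by rewrite psiB; apply: s_gr.
  rewrite psiX; apply: grM => //; last exact: s_gr.
  by apply: grM => //; apply/phi_gr.
have psi_onto n a : gr n a -> exists2 c, grC n c & psi c = a.
  move/standard_span; elim=> {n a} [n|n c u v _ [u' gu <-] _ [v' gv <-]|n e].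
  - by exists 0; [exact: gr0 | rewrite linear0].
  - by exists (c *: u' + v'); [exact: grZD | rewrite linearP].
  case=> [[b gb ->]|[i [d [j [a [x [b [ga Xx gx gb [-> ->]]]]]]]]].
    by exists (iB b) => //; apply: iB_gr.
  have Xx' : x \in X by rewrite inE.
  exists (phi' a * xi (exist _ x Xx') * iB b); last by rewrite psiX phi'K.
  apply: grM => //; last exact: iB_gr.
  by apply: grM => //; [apply/phi_gr; rewrite phi'K | apply: xi_gr].
have psi_inj n c : grC n c -> psi c = 0 -> c = 0.
  move=> gc psi0; have [r rP] := graded_finite n gradedA.
  have phi'_gr a : gr n a -> grC n (phi' a) by move=> ga; apply/phi_gr; rewrite phi'K.
  pose theta : {linear A -> A} := psi \o phiI.
  apply: (can_inj phiK); rewrite linear0.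
  (* The spanning family is projected to degree n, where its members need to lie. *)
  apply: (@surjective_injective _ _ (gr n) theta (size r)
    (fun i => gcomp grA n r`_i)) => [i|p gp|p gp|p gp||] /=.
  - exact: gcompP.
  - have [t e] := in_spanE (rP _ gp); exists t.
    have <- : gcomp grA n p = p by rewrite (gcomp_id _ _ gp) eqxx.
    by rewrite e linear_sum; apply: eq_bigr => i _; rewrite linearZ.
  - exact/psi_gr/phi'_gr.
  - have [c' gc' <-] := psi_onto _ _ gp; exists (phi c'); first exact/phi_gr.
    by rewrite phiK.
  - exact/phi_gr.
  - by rewrite phiK.
exists psi; split=> // [u v e|a].
  apply/eqP; rewrite -subr_eq0; apply/eqP; move: (u - v) (linearB psi u v) => c.
  rewrite e subrr => psi_c.
  (* Being graded, psi commutes with taking components, so injectivity can be tested degree by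
     degree. *)
  have psi_comp n : psi (gcomp gradC n c) = gcomp grA n (psi c).
    have E j : gcomp grA n (psi (gcomp gradC j c)) =
        if n == j then psi (gcomp gradC j c) else 0.
      exact: (gcomp_id grA n (psi_gr _ _ (gcompP gradC j c))).
    rewrite [in RHS](gcompE gradC c) !linear_sum /=.
    under eq_bigr do rewrite E.
    have [lt|ge] := ltnP n (size (gpoly gradC c)).
      rewrite (bigD1 (Ordinal lt)) //= eqxx big1 ?addr0 // => j.
      by rewrite -val_eqE /= eq_sym => /negbTE ->.
    rewrite (gcomp_default ge) linear0 big1 // => j _.
    by rewrite gtn_eqF // (leq_trans (ltn_ord j) ge).
  rewrite [c](gcompE gradC) big1 // => i _.
  by apply: psi_inj; [apply: gcompP | rewrite psi_comp psi_c linear0].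
have /choice[c cP] n : exists c, psi c = gcomp grA n a.
  by have [c _ <-] := psi_onto _ _ (gcompP grA n a); exists c.
exists (\sum_(i < size (gpoly grA a)) c i).
by rewrite linear_sum [RHS](gcompE grA); apply: eq_bigr.
Qed.

(* In other words, I is the free left A-module A (x) W and T' is T (x) id. *)
Lemma kernel_left_free : exists W : set A, [/\ W `<=` [set a | pi a = 0],
  forall S : {pred A}, submod_closed S -> (forall a w, W w -> a * w \in S) ->
    forall a, pi a = 0 -> a \in S &
  forall T : {linear A -> A}, exists T' : {linear A -> A},
    forall a w, W w -> T' (a * w) = T a * w].
Proof.
exists [set w | exists2 x, X x & exists b, w = x * s b]; split.
- by move=> _ [x Xx [b ->]] /=; rewrite rmorphM /= (generator_in_kernel Xx) mul0r.
- move=> S [S0 Slin] WS a pia; rewrite -[a]subr0 -(linear0 s) -pia.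
  (* The map sending e to e - s(pi e) is the identity on the kernel, kills the terms s(b) and fixes
     the terms a x s(b). *)
  have SP n e : graded_span standard_term n e -> e - s (pi e) \in S.
    elim=> {n e} [n|n c u v _ Su _ Sv|n e].
    - by rewrite !linear0 addr0.
    - by rewrite !linearP addrACA -scalerDr; apply: Slin.
    case=> [[b gb ->]|[i [d [j [a' [x [b [ga Xx gx gb [_ ->]]]]]]]]].
      by rewrite sK subrr.
    rewrite !rmorphM /= (generator_in_kernel Xx) mulr0 mul0r linear0 subr0 -mulrA.
    by apply: WS; exists x => //; exists b.
  rewrite [a](gcompE grA) !linear_sum -big_split.
  elim/big_ind: _ => // [u v Su Sv|i _].
    by rewrite -[u]scale1r; apply: Slin.
  exact: (SP _ _ (standard_span (gcompP grA i a))).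
move=> T; have [psi [psi_inj psiB psiX psi_onto]] := comparison_map.
have /choice[psi' psi'K] := psi_onto.
have psiK : cancel psi psi' by move=> c; apply: psi_inj.
have psi'_lin : linear psi' by exact: can2_linear psiK psi'K.
have [phi' phiK phi'K] := phi_bij.
pose pL := GRing.isLinear.Build _ _ _ _ psi' psi'_lin.
pose psiI : {linear A -> C} := HB.pack psi' pL.
have tau_bilin (x : X) : bilinear_fun (fun c b => T (phi c) * val x * s b).
  split=> [b a u v|c a u v]; first by rewrite !linearP !mulrDl -!scalerAl.
  by rewrite linearP mulrDr -scalerAr.
(* [Theta] sends b to 0 and c x b to T(phi c) x s(b). Bilinearity in c and b replaces the choice of
   a basis of [B]; transport along psi gives T'. *)
have [Theta _ ThetaX] := free_extension_rec (\0 : {linear B -> A}) univ tau_bilin.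
exists (Theta \o psiI) => a _ [x Xx [b ->]] /=.
have Xx' : x \in X by rewrite inE.
have <- : psi (phi' a * xi (exist _ x Xx') * iB b) = a * (x * s b).
  by rewrite psiX phi'K mulrA.
by rewrite psiK ThetaX phi'K mulrA.
Qed.

End RelativeCompleteIntersection.

(** * Relations *)

Definition right_submodule (R : nzRingType) (n : nat) (S : set ('I_n -> R)) :=
  [/\ S 0, forall u v, S u -> S v -> S (u + v) &
    forall u c, S u -> S (fun i => u i * c)].

Lemma right_submoduleB (R : nzRingType) (n : nat) (S : set ('I_n -> R)) u v :
  right_submodule S -> S u -> S v -> S (u - v).
Proof.
move=> [_ SD SM] Su Sv; apply: SD => //.
suff -> : - v = fun i => v i * (-1) by apply: SM.
by apply/funext => i; rewrite mulrN1.
Qed.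

Lemma right_submodule_sum (R : nzRingType) (n : nat) (S : set ('I_n -> R))
    (I : Type) (r : seq I) (P : pred I) (F : I -> 'I_n -> R) :
  right_submodule S -> (forall i, P i -> S (F i)) -> S (\sum_(i <- r | P i) F i).
Proof.
by move=> [S0 SD _] SF; elim/big_ind: _ => //; exact: SD.
Qed.

(** The last coordinates of the elements of [Q] form a finitely generated right ideal. Lifts of its
    generators, together with generators of the part of [Q] where this coordinate vanishes, generate
    [Q]. *)
Lemma noetherian_submodule (R : nzRingType) (n : nat) (Q : set ('I_n -> R)) :
    right_noetherian R -> right_submodule Q ->
  exists t : seq ('I_n -> R), (forall v, v \in t -> Q v) /\
    forall S, right_submodule S -> (forall v, v \in t -> S v) -> Q `<=` S.
Proof.
move=> noethR.
(* The induction is on the number [m] of leading coordinates allowed to be nonzero. *)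
suff fg m : forall Q : set ('I_n -> R), right_submodule Q ->
    (forall v, Q v -> forall i : 'I_n, (m <= i)%N -> v i = 0) ->
  exists t : seq ('I_n -> R), (forall v, v \in t -> Q v) /\
    forall S, right_submodule S -> (forall v, v \in t -> S v) -> Q `<=` S.
  by move=> Qsub; apply: (fg n) => // v _ i; rewrite leqNgt ltn_ord.
elim: m {Q} => [|m IH] Q Qsub Qm.
  exists [::]; split=> // S [S0 _ _] _ v Qv.
  by have -> : v = 0 by apply/funext => i; apply: Qm.
have [nm|mn] := leqP n m.
  by apply: IH => // v Qv i; rewrite leqNgt (leq_trans (ltn_ord i) nm).
have [Q0 QD QM] := Qsub; pose o := Ordinal mn.
pose J : set R := [set b | exists2 v, Q v & v o = b].
have [|s sJ] := noethR J.
  split=> [|_ _ [u Qu <-] [v Qv <-]|_ r [u Qu <-]]; first by exists 0.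
    by exists (u + v) => //; apply: QD.
  by exists (fun i => u i * r) => //; apply: QM.
have /choice[l lP] b : exists v, J b -> Q v /\ v o = b.
  have [[v Qv vb]|N] := pselect (J b); first by exists v.
  by exists 0 => /N.
have sub_s b : b \in s -> J b.
  by move=> bs; rewrite sJ; apply: sub_gen_smallest.
pose Q' : set ('I_n -> R) := [set v | Q v /\ v o = 0].
have [||t' [t'Q' t'S]] := IH Q'.
- split=> [|u v [Qu u0] [Qv v0]|u c [Qu u0]]; first by split.
    by split; [apply: QD | rewrite addrfctE u0 v0 addr0].
  by split; [apply: QM | rewrite u0 mul0r].
- move=> v [Qv v0] i; rewrite leq_eqVlt => /orP[/eqP mi|]; last exact: Qm.
  by have -> : i = o by apply: val_inj.
exists ([seq l b | b <- s] ++ t'); split=> [v|S Ssub tS v Qv].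
  rewrite mem_cat => /orP[/mapP[b /sub_s/lP[Qb _] ->]//|/t'Q'[]//].
have [S0 SD SM] := Ssub.
(* A combination of the lifts with the same coordinate as [v]; the difference then falls into
   [Q']. *)
have [v' [Sv' Qv' v'o]] : exists v', [/\ S v', Q v' & v' o = v o].
  have : J (v o) by exists v.
  rewrite sJ; apply: (@smallest_sub _ (@right_ideal R) _
    [set b | exists v', [/\ S v', Q v' & v' o = b]]) => [|b /= bs].
    split=> [|_ _ [x [Sx Qx <-]] [y [Sy Qy <-]]|_ r [x [Sx Qx <-]]].
    - by exists 0.
    - by exists (x + y); split=> //; [apply: SD | apply: QD].
    - by exists (fun i => x i * r); split=> //; [apply: SM | apply: QM].
  have [Qb lb] := lP _ (sub_s _ bs); exists (l b); split=> //.
  by apply: tS; rewrite mem_cat map_f.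
rewrite -[v](subrK v'); apply: SD => //; apply: (t'S S) => // [w wt'|].
  by apply: tS; rewrite mem_cat wt' orbT.
split; first exact: right_submoduleB.
by rewrite !(addrfctE, opprfctE) v'o subrr.
Qed.

(* Tor_1(J, A/I) = 0 for the right ideal J generated by the g i: if K denotes
   the module of relations between them, K meets I^n in K I.  A k-linear map q
   choosing preimages under g extends to I^n via the freeness of I. *)
Lemma relations_in_ideal (k : fieldType) (A B : algType k)
    (pi : {lrmorphism A -> B}) (W : set A) :
    W `<=` [set a | pi a = 0] ->
    (forall S : {pred A}, submod_closed S -> (forall a w, W w -> a * w \in S) ->
      forall a, pi a = 0 -> a \in S) ->
    (forall T : {linear A -> A}, exists T' : {linear A -> A},
      forall a w, W w -> T' (a * w) = T a * w) ->
  forall n (g u : 'I_n -> A) (S : {pred 'I_n -> A}), submod_closed S ->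
    (forall v w, \sum_i g i * v i = 0 -> pi w = 0 -> (fun i => v i * w) \in S) ->
    (forall i, pi (u i) = 0) -> \sum_i g i * u i = 0 -> u \in S.
Proof.
move=> W0 WS Wfree n g u S [S0 Slin] KS pi_u gu.
pose f0 (v : 'I_n -> A) := \sum_i g i * v i.
have f0_lin : linear f0.
  move=> c v w; rewrite /f0 scaler_sumr -big_split; apply: eq_bigr => i _ /=.
  by rewrite scalerAr -mulrDr.
pose fL := GRing.isLinear.Build _ _ _ _ f0 f0_lin.
pose f : {linear ('I_n -> A) -> A} := HB.pack f0 fL.
have [q qP] := linear_pinv f.
have /choice[T TP] (j : 'I_n) : exists T : {linear A -> A},
    forall a w, W w -> T (a * w) = q a j * w.
  have qj_lin : linear (fun a => q a j) by move=> c v w; rewrite linearP.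
  pose qjL := GRing.isLinear.Build _ _ _ _ (fun a => q a j) qj_lin.
  exact: (Wfree (HB.pack (fun a => q a j) qjL : {linear A -> A})).
pose e (i : 'I_n) (a : A) : 'I_n -> A := fun j => if j == i then a else 0.
have f_e i a : f (e i a) = g i * a.
  rewrite /= /f0 (bigD1 i) //= /e eqxx big1 ?addr0 // => j /negbTE ->.
  by rewrite mulr0.
(* For y = a w the column is (e_i a - q(g_i a)) w, and e_i a - q(g_i a) is a relation because f q f
   = f. *)
have key i y : pi y = 0 -> e i y - (fun j => T j (g i * y)) \in S.
  pose Y : {pred A} := [pred y | e i y - (fun j => T j (g i * y)) \in S].
  apply: (WS Y) => [|a w Ww].
    split=> [|c y1 y2]; rewrite !inE.
      suff -> : e i 0 - (fun j => T j (g i * 0)) = 0 by [].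
      apply/funext => j; rewrite !(addrfctE, opprfctE) mulr0 linear0 subr0.
      by rewrite /e; case: eqP.
    move=> Y1 Y2; have := Slin c _ _ Y1 Y2; congr (_ \in S).
    apply/funext => j; rewrite !(addrfctE, opprfctE, scalrfctE).
    rewrite mulrDr -scalerAr linearP /e; case: eqP => _.
      by rewrite scalerBr addrACA opprD.
    by rewrite !sub0r scalerN opprD.
  rewrite inE; have -> : e i (a * w) - (fun j => T j (g i * (a * w))) =
      fun j => (e i a - q (g i * a)) j * w.
    apply/funext => j; rewrite !(addrfctE, opprfctE) mulrA TP // mulrBl.
    by rewrite /e; case: eqP => // _; rewrite mul0r.
  apply: KS; last exact: W0.
  rewrite -[LHS]/(f (e i a - q (g i * a))) linearB /= -[f0 _]/(f _).
  by rewrite -[f0 (q _)]/(f _) -!f_e qP subrr.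
(* The correction terms add up to T_j applied to the sum of the g_i u_i, which is 0. *)
suff -> : u = \sum_i (e i (u i) - (fun j => T j (g i * u i))).
  elim/big_ind: _ => // [v w Sv Sw|i _]; last exact: key.
  by rewrite -[v]scale1r; apply: Slin.
apply/funext => j; rewrite fct_sumE.
rewrite (eq_bigr (fun i => e i (u i) j - T j (g i * u i))) //.
rewrite sumrB -linear_sum gu linear0 subr0.
rewrite (bigD1 j) //= /e eqxx big1 ?addr0 // => i.
by rewrite eq_sym => /negbTE ->.
Qed.

(** * Graded columns and the Nakayama argument *)

Section Columns.
Variables (k : fieldType) (A : algType k) (gr : nat -> set A).
Hypothesis grA : grading gr.
Variables (n : nat) (d : 'I_n -> nat).

Definition homogeneous_column e (v : 'I_n -> A) :=
  forall i, if (d i <= e)%N then gr (e - d i)%N (v i) else v i = 0.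

(** The factor ['X^(d i)] is the degree shift of the i-th basis vector; it makes the coefficient
    vanish for e < d i. *)
Definition ccomp e (u : 'I_n -> A) : 'I_n -> A :=
  fun i => (gpoly grA (u i) * 'X^(d i))`_e.

Lemma ccompE e u i :
  ccomp e u i = if (e < d i)%N then 0 else gcomp grA (e - d i) (u i).
Proof. by rewrite /ccomp coefMXn. Qed.

Lemma ccompZD e c u v : ccomp e (c *: u + v) = c *: ccomp e u + ccomp e v.
Proof.
apply/funext => i; rewrite !(addrfctE, scalrfctE) !ccompE.
by case: ifP => _; rewrite ?scaler0 ?addr0 // linearP.
Qed.

Lemma ccomp0 e : ccomp e 0 = 0.
Proof.
by apply/funext => i; rewrite ccompE; case: ifP => // _; rewrite linear0.
Qed.

Lemma ccompD e u v : ccomp e (u + v) = ccomp e u + ccomp e v.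
Proof. by rewrite -[u]scale1r ccompZD !scale1r. Qed.

Lemma ccompP e u : homogeneous_column e (ccomp e u).
Proof.
by move=> i; rewrite ccompE ltnNge; case: leqP => // _; apply: gcompP.
Qed.

Lemma ccomp_id e e' v : homogeneous_column e' v ->
  ccomp e v = if e == e' then v else 0.
Proof.
move=> hv; apply/funext => i; rewrite ccompE; move: (hv i).
case: (leqP (d i) e') => [de' gv|_ vi]; last first.
  by rewrite vi linear0 if_same; case: eqP; rewrite ?vi.
rewrite (gcomp_id _ _ gv); case: (e =P e') => [->|ne].
  by rewrite ltnNge de' eqxx.
by case: ltnP => // de; case: eqP => // E; case: ne; lia.
Qed.

Lemma ccompM e u c :
  ccomp e (fun i => u i * c) =
  \sum_(j < e.+1) (fun i => ccomp (e - j) u i * gcomp grA j c).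
Proof.
apply/funext => i; rewrite fct_sumE /ccomp gpolyM -mulrA.
by rewrite (commr_polyXn (gpoly grA c)) mulrA coefMr.
Qed.

Lemma ccomp_sum u : exists N, u = \sum_(e < N) ccomp e u.
Proof.
exists (\max_i (size (gpoly grA (u i)) + d i)); apply/funext => i.
rewrite fct_sumE /ccomp; set p := _ * _.
have <- : p.[1] = u i.
  rewrite /p hornerM_comm ?gpoly1 ?horner_exp_comm ?hornerX ?expr1n ?mulr1 //.
    by rewrite /comm_poly hornerX.
  by rewrite /comm_poly horner_exp_comm ?hornerX ?expr1n ?mulr1 // /comm_poly hornerX.
rewrite (@horner_coef_wide _ (\max_i (size (gpoly grA (u i)) + d i))).
  by apply: eq_bigr => e _; rewrite expr1n mulr1.
apply: leq_trans (leq_bigmax i); apply: leq_trans (size_polyMleq _ _) _.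
by rewrite size_polyXn addnS.
Qed.

Variable g : 'I_n -> A.
Hypothesis g_gr : forall i, gr (d i) (g i).

Definition relations : set ('I_n -> A) := [set u | \sum_i g i * u i = 0].

Lemma relations_submodule : right_submodule relations.
Proof.
split=> [|u v|u c]; rewrite /relations /=.
- by rewrite big1 // => i _; rewrite mulr0.
- move=> gu gv; rewrite (eq_bigr (fun i => g i * u i + g i * v i)) => [|i _].
    by rewrite big_split /= gu gv addr0.
  by rewrite -mulrDr.
- move=> gu; under eq_bigr do rewrite mulrA.
  by rewrite -mulr_suml gu mul0r.
Qed.

Lemma relations_ccomp e u : relations u -> relations (ccomp e u).
Proof.
rewrite /relations /= => gu.
transitivity (gcomp grA e (\sum_i g i * u i)); last by rewrite gu linear0.
rewrite linear_sum; apply: eq_bigr => i _; rewrite /= (gcompMl _ _ _ (g_gr i)) ccompE.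
by case: ifP => // _; rewrite mulr0.
Qed.

Variables (B : algType k) (pi : {lrmorphism A -> B}) (W : set A).
Hypothesis noethB : right_noetherian B.
Hypothesis pi_surj : range pi = setT.
Hypothesis pi_degree0 : forall a, gr 0 a -> pi a = 0 -> a = 0.
Hypothesis pi_gcomp : forall m a, pi a = 0 -> pi (gcomp grA m a) = 0.
Hypothesis W0 : W `<=` [set a | pi a = 0].
Hypothesis W_span : forall S : {pred A}, submod_closed S ->
  (forall a w, W w -> a * w \in S) -> forall a, pi a = 0 -> a \in S.
Hypothesis W_free : forall T : {linear A -> A}, exists T' : {linear A -> A},
  forall a w, W w -> T' (a * w) = T a * w.

Definition image_column (u : 'I_n -> A) : 'I_n -> B := fun i => pi (u i).

Lemma image_columnD u v : image_column (u + v) = image_column u + image_column v.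
Proof. by apply/funext => i; rewrite /image_column !addrfctE rmorphD. Qed.

Lemma image_submodule (S : set ('I_n -> A)) :
  right_submodule S -> right_submodule (image_column @` S).
Proof.
move=> [S0 SD SM]; split=> [|_ _ [u Su <-] [v Sv <-]|_ b [u Su <-]].
- by exists 0 => //; apply/funext => i; rewrite /image_column rmorph0.
- by exists (u + v); [apply: SD | rewrite image_columnD].
have [a _ <-] : range pi b by rewrite pi_surj.
exists (fun i => u i * a); first exact: SM.
by apply/funext => i; rewrite /image_column rmorphM.
Qed.

(** Let L be generated by the homogeneous components of finitely many relations whose images
    generate the image of K in B^n. Modulo L, a relation u may be assumed to have entries in I,
    hence to be a sum of v w with v in K and w in I. As w has no component of degree 0, the degree e
    part of v w only involves parts of v of smaller degree, which lie in L by induction. *)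
Lemma relations_fg : exists T : seq (nat * ('I_n -> A)),
  (forall p, p \in T -> relations p.2 /\ homogeneous_column p.1 p.2) /\
  forall S, right_submodule S -> (forall p, p \in T -> S p.2) -> relations `<=` S.
Proof.
have Ksub := relations_submodule.
have [t [tK tS]] := noetherian_submodule noethB (image_submodule Ksub).
have /choice[l lP] v : exists u, v \in t -> relations u /\ image_column u = v.
  have [/tK[u Ku uv]|_] := boolP (v \in t); first by exists u.
  by exists 0.
have /choice[N NP] u := ccomp_sum u.
pose T := [seq (e, ccomp e (l v)) | v <- t, e <- iota 0 (N (l v))].
have TP p : p \in T -> relations p.2 /\ homogeneous_column p.1 p.2.
  move=> /allpairsPdep[v [e [vt _ ->]]] /=; split; last exact: ccompP.
  by apply: relations_ccomp; case: (lP _ vt).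
exists T; split=> // S0 S0sub TS0.
pose L : set ('I_n -> A) :=
  [set u | forall S, right_submodule S -> (forall p, p \in T -> S p.2) -> S u].
suff KL : relations `<=` L by move=> u /KL/(_ S0 S0sub TS0).
have Lsub : right_submodule L.
  split=> [S [S0' _ _] _ //|u v Lu Lv S Ssub TS|u c Lu S Ssub TS].
    by have [_ SD _] := Ssub; apply: SD; [exact: Lu | exact: Lv].
  by have [_ _ SM] := Ssub; exact: (SM u c (Lu S Ssub TS)).
have [L0 LD LM] := Lsub.
have TL p : p \in T -> L p.2 by move=> pT S _; apply.
have LK : L `<=` relations by move=> u; apply=> // p /TP[].
(* L is a graded submodule, being generated by homogeneous columns. *)
have Lcc u e : L u -> L (ccomp e u).
  move=> Lu; apply: (Lu [set u | forall e, L (ccomp e u)]) => [|p pT e'].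
    split=> [e'|v w Lv Lw e'|v c Lv e'] /=; first by rewrite ccomp0.
      by rewrite ccompD; exact: LD (Lv _) (Lw _).
    rewrite ccompM; apply: right_submodule_sum => // j _.
    exact: LM (Lv _).
  have [_ hp] := TP _ pT; rewrite (ccomp_id _ hp).
  by case: eqP => _ //; apply: TL.
have lL v : v \in t -> L (l v).
  move=> vt; rewrite [l v]NP; apply: right_submodule_sum => // e _.
  apply: (TL (nat_of_ord e, _)).
  apply: (@allpairs_f_dep _ _ _ (fun v e => (e, ccomp e (l v)))) => //.
  by rewrite mem_iota add0n /=.
have KLe e u : relations u -> L (ccomp e u).
  elim/ltn_ind: e u => e IH u Ku.
  have [u' Lu' u'E] : (image_column @` L) (image_column u).
    apply: tS; [exact: image_submodule | move=> v vt | by exists u].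
    by exists (l v); [apply: lL | case: (lP _ vt)].
  rewrite -[u](subrK u') ccompD; apply: (LD _ _); last exact: Lcc.
  pose S : {pred 'I_n -> A} := [pred v | `[< L (ccomp e v) >]].
  suff /asboolP : u - u' \in S by [].
  apply: (relations_in_ideal W0 W_span W_free (g := g)) => [|v w Kv pi_w|i|].
  - split=> [|c x y /asboolP Lx /asboolP Ly]; apply/asboolP.
      by rewrite ccomp0.
    rewrite ccompZD; apply: (LD _ _) => //.
    suff -> : c *: ccomp e x = fun i => ccomp e x i * c%:A by apply: (LM _ _).
    by apply/funext => i; rewrite scalrfctE mulr_algr.
  - apply/asboolP; rewrite ccompM; apply: right_submodule_sum => // -[[|j] je] _ /=.
      (* The only term reaching degree e of [v] has the degree 0 part of w as a factor, which is
         0. *)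
      rewrite (pi_degree0 (gcompP grA 0 w)) ?pi_gcomp //.
      suff -> : (fun i => ccomp (e - 0) v i * 0) = 0 by [].
      by apply/funext => i; rewrite mulr0.
    by apply: (LM _ _); apply: IH => //; lia.
  - rewrite addrfctE opprfctE rmorphB /=.
    by have /(congr1 (@^~ i)) := u'E; rewrite /image_column => ->; rewrite subrr.
  - exact: (right_submoduleB Ksub Ku (LK _ Lu')).
move=> u Ku; rewrite [u]NP; apply: right_submodule_sum => // e _.
exact: KLe.
Qed.

End Columns.

(** * Homogeneous generators and the finite presentation *)

Lemma homogeneous_generators (k : fieldType) (A : algType k) (gr : nat -> set A)
    (J : set A) :
    grading gr -> right_ideal J -> homogeneous gr J -> finitely_generated_right J ->
  exists n (d : 'I_n -> nat) (g : 'I_n -> A), (forall i, gr (d i) (g i)) /\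
    forall a, J a <-> exists u : 'I_n -> A, a = \sum_i g i * u i.
Proof.
move=> grA [J0 JD JM] Jh [s sJ].
pose G := [seq (i, gcomp grA i a) | a <- s, i <- iota 0 (size (gpoly grA a))].
pose p (i : 'I_(size G)) := nth (0%N, 0) G i.
have pG i : p i \in G by apply: mem_nth.
have GP x : x \in G -> gr x.1 x.2 /\ J x.2.
  move=> /allpairsPdep[a [i [sa _ ->]]] /=; split; first exact: gcompP.
  have [hJ _] := homogeneousP grA JD J0; apply: (hJ Jh).
  by rewrite sJ; exact: sub_gen_smallest.
exists (size G), (fun i => (p i).1), (fun i => (p i).2); split=> [i|a].
  by case: (GP _ (pG i)).
split=> [|[u ->]]; last first.
  elim/big_ind: _ => // i _.
  by apply: JM; case: (GP _ (pG i)).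
have I_ideal : right_ideal
    [set a | exists u : 'I_(size G) -> A, a = \sum_i (p i).2 * u i].
  split=> [|_ _ [u ->] [v ->]|_ r [u ->]].
  - by exists (fun=> 0); rewrite big1 // => i _; rewrite mulr0.
  - exists (fun i => u i + v i); rewrite -big_split.
    by apply: eq_bigr => i _; rewrite mulrDr.
  - exists (fun i => u i * r); rewrite mulr_suml.
    by apply: eq_bigr => i _; rewrite mulrA.
rewrite sJ; apply: (@smallest_sub _ (@right_ideal A) _ _ I_ideal) => b /= bs.
have [I0 ID _] := I_ideal.
rewrite [b](gcompE grA); apply: (big_ind _ I0 ID) => i _.
have xG : (nat_of_ord i, gcomp grA i b) \in G.
  apply: (@allpairs_f_dep _ _ _ (fun a i => (i, gcomp grA i a))) => //.
  by rewrite mem_iota add0n /=.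
have jG : (index (nat_of_ord i, gcomp grA i b) G < size G)%N by rewrite index_mem.
exists (fun j => (j == Ordinal jG)%:R); rewrite (bigD1 (Ordinal jG)) //= eqxx mulr1.
rewrite /p nth_index //= big1 ?addr0 // => j /negbTE ->.
by rewrite mulr0.
Qed.

Theorem corollary3p3 (k : fieldType) (A : algType k) (gr : nat -> set A)
    (B : algType k) (pi : {lrmorphism A -> B}) :
  graded_algebra gr -> RNCI gr pi -> right_noetherian B ->
  right_graded_coherent gr.
Proof.
move=> gradedA [X [Xh _ [B' [pi' [quot' ext]]]] quot] noethB J Jid Jh Jfg.
have grA : grading gr by case: gradedA.
have [F [iota [C [iB [iF [grC [phi [[freeF prodC] gradC iBgr xigr]]]]]]]] := ext.
move=> [phi_bij phi_gr].
have [s sK s_gr] := graded_section quot'.1 (kernel_gcomp gradedA Xh quot').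
have [W [W0 WS Wfree]] := kernel_left_free gradedA Xh quot' sK s_gr
  (free_product_extension freeF prodC) gradC iBgr xigr phi_bij phi_gr.
(* Strong freeness comes with its own quotient map [pi'], while the Noetherian hypothesis concerns
   the target of [pi]; both kernels are (X). *)
have kerE a : pi' a = 0 <-> pi a = 0.
  by rewrite (kernelP quot') (kernelP quot).
have {Jid Jh Jfg}[n [d [g [g_gr JE]]]] := homogeneous_generators grA Jid Jh Jfg.
have W0' : W `<=` [set a | pi a = 0] by move=> w /W0/kerE.
have WS' (S : {pred A}) : submod_closed S ->
    (forall a w, W w -> a * w \in S) -> forall a, pi a = 0 -> a \in S.
  by move=> Ssub SW a /kerE; apply: WS.
have [T [TP TS]] := relations_fg g_gr noethB quot.1
  (@kernel_degree0 _ _ _ gradedA _ pi) (kernel_gcomp gradedA Xh quot) W0' WS' Wfree.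
pose p (j : 'I_(size T)) := nth (0%N, 0) T j.
have pT j : p j \in T by apply: mem_nth.
(* The columns of h are the generating relations, with their degrees as the degrees of the basis of
   F1. *)
exists n, (size T), d, (fun j => (p j).1), (\row_i g i), (\matrix_(i, j) (p j).2 i).
have gE (u : 'cV[A]_n) : ((\row_i g i) *m u) 0 0 = \sum_i g i * u i 0.
  by rewrite mxE; apply: eq_bigr => i _; rewrite mxE.
split=> [i|i j||].
- by rewrite mxE.
- by have [_ /(_ i)] := TP _ (pT j); rewrite !mxE.
- apply/seteqP; split=> [a /JE[u ->]|_ [u _ <-]]; last first.
    by apply/JE; exists (u^~ 0); rewrite gE.
  by exists (\col_i u i) => //; rewrite gE; apply: eq_bigr => i _; rewrite mxE.
apply/seteqP; split=> [u /= gu|_ [c _ <-]] /=; last first.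
  rewrite mulmxA -[RHS](mul0mx _ c); congr (_ *m _); apply/rowP => j.
  have [Kj _] := TP _ (pT j); rewrite [RHS]mxE -[RHS]Kj mxE.
  by apply: eq_bigr => i _; rewrite !mxE.
(* The column space of h, a right submodule containing the generating relations. *)
pose S : set ('I_n -> A) :=
  [set v | exists c : 'I_(size T) -> A, forall i, v i = \sum_j (p j).2 i * c j].
have Ssub : right_submodule S.
  split=> [|v w [c vE] [c' wE]|v r [c vE]].
  - by exists (fun=> 0) => i; rewrite big1 // => j _; rewrite mulr0.
  - exists (fun j => c j + c' j) => i; rewrite addrfctE vE wE -big_split.
    by apply: eq_bigr => j _; rewrite mulrDr.
  - exists (fun j => c j * r) => i; rewrite vE mulr_suml.
    by apply: eq_bigr => j _; rewrite mulrA.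
have [x xT||c cE] := TS S Ssub _ (u^~ 0).
- have jT : (index x T < size T)%N by rewrite index_mem.
  exists (fun j => (j == Ordinal jT)%:R) => i.
  rewrite (bigD1 (Ordinal jT)) //= eqxx mulr1 /p nth_index // big1 ?addr0 //.
  by move=> j /negbTE ->; rewrite mulr0.
- by rewrite /relations /= -gE gu mxE.
exists (\col_j c j) => //; apply/colP=> i; rewrite mxE cE.
by apply: eq_bigr => j _; rewrite !mxE.
Qed.
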